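(* Let $(R,\mathfrak m)$ be a one-dimensional Cohen-Macaulay local ring that is an Arf ring. Suppose that $\overline{R}$ is finitely generated as an $R$-module and is a local ring. Then the set $\mathrm{Tr}(R)$ of trace ideals of $R$ is finite.
   Context: All rings are commutative. For a ring $R$ and an $R$-module $M$, the trace ideal of $M$ is $\mathrm{tr}_R(M)=\sum_{f\in\operatorname{Hom}_R(M,R)}\operatorname{Im} f$. An ideal $I$ of $R$ is a trace ideal in $R$ if $I=\mathrm{tr}_R(M)$ for some $R$-module $M$ (equivalently, $I=\mathrm{tr}_R(I)$). $\mathrm{Tr}(R)$ is the set of all trace ideals in $R$. $\mathrm{Q}(R)$ is the total ring of fractions of $R$, $\overline{R}$ the integral closure of $R$ in $\mathrm{Q}(R)$, and for fractional ideals $I,J$, $I:J=\{\alpha\in\mathrm{Q}(R)\mid\alpha J\subseteq I\}$. For a ring $A$, $J(A)$ denotes its Jacobson radical. Let $R$ be a one-dimensional Cohen-Macaulay local ring. Put $R_0=R$, $R_1=\bigcup_{i\ge0}[J(R)^i:J(R)^i]$, and recursively $R_n=[R_{n-1}]_1=\bigcup_{i\ge 0}[J(R_{n-1})^i:J(R_{n-1})^i]$ for $n>0$; this gives a tower $R=R_0\subseteq R_1\subseteq\cdots\subseteq\overline{R}$ of Cohen-Macaulay semi-local rings all of whose maximal ideals have height one. By Lipman's characterization (used here as the definition), $R$ is an Arf ring if and only if the local ring $[R_n]_{\mathfrak M}$ has minimal multiplicity for every $n\ge0$ and every maximal ideal $\mathfrak M$ of $R_n$. A Cohen-Macaulay local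 ring $(A,\mathfrak n)$ of dimension one has minimal multiplicity if its multiplicity equals its embedding dimension, equivalently $\mathfrak n^2=a\mathfrak n$ for some $a\in\mathfrak n$. *)

(* Defs.v *)
From HB Require Import structures.
From mathcomp Require Import all_boot all_order all_algebra.
From mathcomp Require Import boolp classical_sets functions cardinality.
From mathcomp Require Import ring.

Set Implicit Arguments.
Unset Strict Implicit.
Unset Printing Implicit Defensive.

Import GRing.Theory.
Local Open Scope classical_set_scope.
Local Open Scope ring_scope.
Local Open Scope quotient_scope.

Section Ideals.
Variable R : comNzRingType.
Implicit Types (I J M P : set R) (s : seq R).

Definition ideal I : Prop :=
  [/\ I 0, forall x y, I x -> I y -> I (x + y) & forall a x, I x -> I (a * x)].

Definition prime_ideal P : Prop :=
  [/\ ideal P, ~ P 1 & forall x y, P (x * y) -> P x \/ P y].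

Definition maximal_ideal M : Prop :=
  [/\ ideal M, ~ M 1 & forall J, ideal J -> ~ J 1 -> M `<=` J -> J = M].

Definition jacobson_radical : set R :=
  [set x | forall M, maximal_ideal M -> M x].

Definition local_ring M : Prop :=
  maximal_ideal M /\ forall N, maximal_ideal N -> N = M.

Definition ideal_mul I J : set R :=
  [set x | exists n (a b : 'I_n -> R), [/\ forall i, I (a i),
     forall i, J (b i) & x = \sum_i a i * b i]].

Fixpoint ideal_exp I n : set R :=
  if n is n'.+1 then ideal_mul I (ideal_exp I n') else setT.

End Ideals.

(* the R-submodule of Q generated by s, where Q is an R-algebra through f *)
Definition span (R Q : comNzRingType) (f : R -> Q) (s : seq Q) : set Q :=
  [set x | exists a : 'I_(size s) -> R, x = \sum_i f (a i) * s`_i].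

Definition ideal_gen (R : comNzRingType) (s : seq R) : set R := span id s.

(* A chain p 0 < ... < p n has length n; sup_chain_length says that the
   supremum of the lengths is n, in particular that it is finite. *)
Definition chain T (C : set T -> Prop) (n : nat) (p : nat -> set T) : Prop :=
  (forall i, (i <= n)%N -> C (p i)) /\ (forall i, (i < n)%N -> p i `<` p i.+1).

Definition sup_chain_length T (C : set T -> Prop) (n : nat) : Prop :=
  (exists p, chain C n p) /\ (forall k p, chain C k p -> (k <= n)%N).

Section Invariants.
Variable R : comNzRingType.
Implicit Types (I M : set R) (s : seq R).

Definition noetherian : Prop :=
  forall I, ideal I -> exists s, I = ideal_gen s.

Definition krull_dim (d : nat) : Prop := sup_chain_length (@prime_ideal R) d.

Definition regular_sequence s : Prop :=
  (forall i, (i < size s)%N ->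
     forall x, ideal_gen (take i s) (s`_i * x) -> ideal_gen (take i s) x)
  /\ ~ ideal_gen s 1.

Definition regular_sequence_in M s : Prop :=
  regular_sequence s /\ {in s, forall x, M x}.

Definition depth M (d : nat) : Prop :=
  (exists s, regular_sequence_in M s /\ size s = d) /\
  (forall s, regular_sequence_in M s -> (size s <= d)%N).

Definition cohen_macaulay_local M (d : nat) : Prop :=
  [/\ noetherian, local_ring M, krull_dim d & depth M d].

(* the length of the R-module R/I; its submodules are the K/I *)
Definition quotient_length I (l : nat) : Prop :=
  sup_chain_length (fun K => ideal K /\ I `<=` K) l.

(* the Hilbert-Samuel multiplicity in dimension one: the leading coefficient of
   the (degree one) polynomial giving the length of R/M^k for large k *)
Definition multiplicity1 M (e : nat) : Prop :=
  exists (c : int) (N : nat), forall k, (N <= k)%N ->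
    exists2 l : nat, quotient_length (ideal_exp M k) l &
                     l%:Z = e%:Z * k%:Z + c.

Definition embedding_dim M (e : nat) : Prop :=
  (exists s, M = ideal_gen s /\ size s = e) /\
  (forall s, M = ideal_gen s -> (e <= size s)%N).

Definition minimal_multiplicity : Prop :=
  exists M, local_ring M /\ exists e, multiplicity1 M e /\ embedding_dim M e.

End Invariants.

Arguments noetherian R : clear implicits.
Arguments krull_dim R d : clear implicits.
Arguments minimal_multiplicity R : clear implicits.

Record mul_subset (R : comNzRingType) := MulSubset {
  mul_subset_set :> set R;
  mul_subset1 : mul_subset_set 1;
  mul_subsetM : forall x y,
    mul_subset_set x -> mul_subset_set y -> mul_subset_set (x * y);
  mul_subset0 : ~ mul_subset_set 0 }.

Section Localization.
Variables (R : comNzRingType) (S : mul_subset R).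

Local Notation D := (mul_subset_set S).
Local Notation frac_dom := (R * set_type D)%type.
Implicit Types x y z : frac_dom.

Definition den x : R := val x.2.
Lemma denP x : D (den x). Proof. by apply: set_mem; apply: valP. Qed.

Definition mk_frac (a s : R) (hs : D s) : frac_dom := (a, SigSub (mem_set hs)).

Definition frac_equiv x y : bool :=
  `[< exists2 u, D u & u * (x.1 * den y) = u * (y.1 * den x) >].

Lemma frac_equiv_refl : reflexive frac_equiv.
Proof. by move=> x; apply/asboolP; exists 1 => //; apply: mul_subset1. Qed.

Lemma frac_equiv_sym : symmetric frac_equiv.
Proof.
by move=> x y; apply/asboolP/asboolP => -[u Su e]; exists u.
Qed.

Lemma frac_equiv_trans : transitive frac_equiv.
Proof.
move=> y x z /asboolP[u Su e1] /asboolP[v Sv e2]; apply/asboolP.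
exists (u * v * den y).
  by apply: mul_subsetM (denP y); apply: mul_subsetM.
transitivity (v * den z * (u * (x.1 * den y))); first by ring.
rewrite e1; transitivity (u * den x * (v * (y.1 * den z))); first by ring.
by rewrite e2; ring.
Qed.

Canonical frac_equiv_rel :=
  EquivRel frac_equiv frac_equiv_refl frac_equiv_sym frac_equiv_trans.

Definition localization := {eq_quot frac_equiv}.
HB.instance Definition _ : EqQuotient _ frac_equiv localization :=
  EqQuotient.on localization.
HB.instance Definition _ := Choice.on localization.

Definition frac (a s : R) (hs : D s) : localization :=
  \pi_localization (mk_frac a hs).

Lemma frac_eqP a s (hs : D s) b t (ht : D t) :
  frac a hs = frac b ht <-> exists2 u, D u & u * (a * t) = u * (b * s).
Proof. by split=> [/eqmodP/asboolP // | h]; apply/eqmodP/asboolP. Qed.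

Lemma fracP (q : localization) : exists a s (hs : D s), q = frac a hs.
Proof.
elim/quotW: q => x; exists x.1, (den x), (denP x).
by apply/eqmodP/asboolP; exists 1 => //; apply: mul_subset1.
Qed.

Definition repr_frac (q : localization) : frac_dom := repr q.

Definition loc_add (p q : localization) : localization :=
  frac ((repr_frac p).1 * den (repr_frac q) + (repr_frac q).1 * den (repr_frac p))
       (mul_subsetM (denP (repr_frac p)) (denP (repr_frac q))).
Definition loc_mul (p q : localization) : localization :=
  frac ((repr_frac p).1 * (repr_frac q).1)
       (mul_subsetM (denP (repr_frac p)) (denP (repr_frac q))).
Definition loc_opp (p : localization) : localization :=
  frac (- (repr_frac p).1) (denP (repr_frac p)).

Let reprE a s (hs : D s) : exists2 u, D u &
  u * ((repr_frac (frac a hs)).1 * s) = u * (a * den (repr_frac (frac a hs))).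
Proof.
have: frac (repr_frac (frac a hs)).1 (denP (repr_frac (frac a hs))) = frac a hs.
  rewrite -[RHS]reprK; apply/eqmodP/asboolP.
  by exists 1 => //; apply: mul_subset1.
by case/frac_eqP => u Su e; exists u.
Qed.

Lemma loc_addE a s (hs : D s) b t (ht : D t) :
  loc_add (frac a hs) (frac b ht) = frac (a * t + b * s) (mul_subsetM hs ht).
Proof.
apply/frac_eqP; have [u Su e1] := reprE a hs; have [v Sv e2] := reprE b ht.
move: (repr_frac (frac a hs)) (repr_frac (frac b ht)) e1 e2 => p q e1 e2.
exists (u * v); first exact: mul_subsetM.
transitivity (v * den q * t * (u * (p.1 * s)) + u * den p * s * (v * (q.1 * t))).
  by ring.
by rewrite e1 e2; ring.
Qed.

Lemma loc_mulE a s (hs : D s) b t (ht : D t) :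
  loc_mul (frac a hs) (frac b ht) = frac (a * b) (mul_subsetM hs ht).
Proof.
apply/frac_eqP; have [u Su e1] := reprE a hs; have [v Sv e2] := reprE b ht.
move: (repr_frac (frac a hs)) (repr_frac (frac b ht)) e1 e2 => p q e1 e2.
exists (u * v); first exact: mul_subsetM.
transitivity ((u * (p.1 * s)) * (v * (q.1 * t))); first by ring.
by rewrite e1 e2; ring.
Qed.

Lemma loc_oppE a s (hs : D s) : loc_opp (frac a hs) = frac (- a) hs.
Proof.
apply/frac_eqP; have [u Su e1] := reprE a hs.
by exists u => //; rewrite !mulNr !mulrN e1.
Qed.

Let frac_eq a s (hs : D s) b t (ht : D t) : a * t = b * s -> frac a hs = frac b ht.
Proof.
by move=> e; apply/frac_eqP; exists 1; [apply: mul_subset1 | rewrite e].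
Qed.

Definition loc0 : localization := frac 0 (mul_subset1 S).
Definition loc1 : localization := frac 1 (mul_subset1 S).

Lemma loc_addA : associative loc_add.
Proof.
move=> p q r; have [a [s [hs ->]]] := fracP p; have [b [t [ht ->]]] := fracP q.
have [c [w [hw ->]]] := fracP r; rewrite !loc_addE; apply: frac_eq; ring.
Qed.

Lemma loc_addC : commutative loc_add.
Proof.
move=> p q; have [a [s [hs ->]]] := fracP p; have [b [t [ht ->]]] := fracP q.
by rewrite !loc_addE; apply: frac_eq; ring.
Qed.

Lemma loc_add0 : left_id loc0 loc_add.
Proof.
move=> p; have [a [s [hs ->]]] := fracP p.
by rewrite loc_addE; apply: frac_eq; ring.
Qed.

Lemma loc_addN : left_inverse loc0 loc_opp loc_add.
Proof.
move=> p; have [a [s [hs ->]]] := fracP p.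
by rewrite loc_oppE loc_addE; apply: frac_eq; ring.
Qed.

HB.instance Definition _ :=
  GRing.isZmodule.Build localization loc_addA loc_addC loc_add0 loc_addN.

Lemma loc_mulA : associative loc_mul.
Proof.
move=> p q r; have [a [s [hs ->]]] := fracP p; have [b [t [ht ->]]] := fracP q.
have [c [w [hw ->]]] := fracP r; rewrite !loc_mulE; apply: frac_eq; ring.
Qed.

Lemma loc_mulC : commutative loc_mul.
Proof.
move=> p q; have [a [s [hs ->]]] := fracP p; have [b [t [ht ->]]] := fracP q.
by rewrite !loc_mulE; apply: frac_eq; ring.
Qed.

Lemma loc_mul1 : left_id loc1 loc_mul.
Proof.
move=> p; have [a [s [hs ->]]] := fracP p.
by rewrite loc_mulE; apply: frac_eq; ring.
Qed.

Lemma loc_mulDl : left_distributive loc_mul loc_add.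
Proof.
move=> p q r; have [a [s [hs ->]]] := fracP p; have [b [t [ht ->]]] := fracP q.
have [c [w [hw ->]]] := fracP r.
by rewrite !(loc_mulE, loc_addE); apply: frac_eq; ring.
Qed.

Lemma loc1_neq0 : loc1 != loc0.
Proof.
apply/eqP => /frac_eqP[u Su]; rewrite !mulr1 mulr0 => u0.
by move: Su; rewrite u0; apply: mul_subset0.
Qed.

HB.instance Definition _ := GRing.Zmodule_isComNzRing.Build localization
  loc_mulA loc_mulC loc_mul1 loc_mulDl loc1_neq0.

Definition to_loc (a : R) : localization := frac a (mul_subset1 S).

Lemma to_loc_is_zmod_morphism : zmod_morphism to_loc.
Proof.
move=> a b; rewrite /to_loc.
rewrite [RHS](_ : _ = loc_add (to_loc a) (loc_opp (to_loc b))) //.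
by rewrite loc_oppE loc_addE; apply: frac_eq; ring.
Qed.
HB.instance Definition _ :=
  GRing.isZmodMorphism.Build R localization to_loc to_loc_is_zmod_morphism.

Lemma to_loc_is_monoid_morphism : monoid_morphism to_loc.
Proof.
split=> // a b; rewrite [RHS](_ : _ = loc_mul (to_loc a) (to_loc b)) //.
by rewrite loc_mulE; apply: frac_eq; ring.
Qed.
HB.instance Definition _ :=
  GRing.isMonoidMorphism.Build R localization to_loc to_loc_is_monoid_morphism.

End Localization.

Section LocalizationAtMaximal.
Variable R : comNzRingType.

Lemma maximal_prime (M : set R) : maximal_ideal M -> prime_ideal M.
Proof.
move=> [idM M1 maxM]; have [M0 MD MM] := idM; split=> // x y Mxy.
have [Mx|nMx] := pselect (M x); [by left | right].
pose J := [set z | exists a b, M a /\ z = a + b * x].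
have idJ : ideal J.
  split; first by exists 0, 0; rewrite mul0r addr0.
    move=> _ _ [a [b [Ma ->]]] [c [d [Mc ->]]].
    by exists (a + c), (b + d); split; [apply: MD | ring].
  move=> r _ [a [b [Ma ->]]]; exists (r * a), (r * b).
  by split; [apply: MM | ring].
have [[a [b [Ma e]]]|J1] := pselect (J 1).
  rewrite -[y]mulr1 e; have -> : y * (a + b * x) = y * a + b * (x * y) by ring.
  by apply: MD; apply: MM.
case: nMx; rewrite -(maxM J idJ J1); first by exists 0, 1; rewrite mul1r add0r.
by move=> z Mz; exists z, 0; rewrite mul0r addr0.
Qed.

Definition prime_compl (P : set R) (hP : prime_ideal P) : mul_subset R.
Proof.
exists (~` P); first by case: hP.
- by case: hP => _ _ Pxy x y nPx nPy /Pxy[].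
- by case: hP => -[P0 _ _] _ _; apply.
Defined.

Definition localization_at (P : set R) (hP : prime_ideal P) : comNzRingType :=
  localization (prime_compl hP).

Definition nonzerodivisors : mul_subset R.
Proof.
exists [set x | GRing.lreg x]; first exact: lreg1.
- by move=> x y; apply: lregM.
- by move=> /(_ 0 1); rewrite !mul0r => /(_ erefl)/esym/eqP; rewrite oner_eq0.
Defined.

Definition total_fractions : comNzRingType := localization nonzerodivisors.

Definition to_total : {rmorphism R -> total_fractions} :=
  to_loc nonzerodivisors.

End LocalizationAtMaximal.

Arguments total_fractions R : clear implicits.
Arguments to_total R : clear implicits.

Record subring (Q : comNzRingType) := Subring {
  subring_set : set Q;
  subring_closedP : GRing.subring_closed [in subring_set] }.

Section SubringType.
Variables (Q : comNzRingType) (A : subring Q).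

Definition subring_pred : {pred Q} := [in subring_set A].

HB.instance Definition _ :=
  GRing.isSubringClosed.Build Q subring_pred (subring_closedP A).

Record subring_sort := SubringElt
  { subring_val :> Q; _ : subring_val \in subring_pred }.

HB.instance Definition _ := [isSub for subring_val].
HB.instance Definition _ := [Choice of subring_sort by <:].
HB.instance Definition _ :=
  [SubChoice_isSubComNzRing of subring_sort by <:].

Definition subring_ring : comNzRingType := subring_sort.

End SubringType.

Coercion subring_ring : subring >-> GRing.ComNzRing.type.

Definition colon (Q : comNzRingType) (I J : set Q) : set Q :=
  [set a | forall y, J y -> I (a * y)].

Section IdealLemmas.
Variable R : comNzRingType.
Implicit Types I J M : set R.

Lemma idealB I x y : ideal I -> I x -> I y -> I (x - y).
Proof. by move=> [_ ID IM] Ix Iy; apply: ID => //; rewrite -mulN1r; apply: IM. Qed.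

Lemma ideal_mul_ideal I J : ideal I -> ideal (ideal_mul I J).
Proof.
move=> [_ _ IM]; split.
- by exists 0, (fun=> 0), (fun=> 0); split; [case | case | rewrite big_ord0].
- move=> _ _ [n [a [b [Ia Jb ->]]]] [m [c [d [Ic Jd ->]]]].
  exists (n + m)%N, (fun i => match fintype.split i with inl j => a j | inr j => c j end),
    (fun i => match fintype.split i with inl j => b j | inr j => d j end).
  split=> [i|i|]; [by case: (fintype.split i) | by case: (fintype.split i) |].
  by rewrite big_split_ord; congr (_ + _); apply: eq_bigr => i _;
    rewrite ?(unsplitK (inl i)) ?(unsplitK (inr i)).
- move=> r _ [n [a [b [Ia Jb ->]]]]; exists n, (fun i => r * a i), b.
  split=> // [i|]; first exact: IM.
  by rewrite mulr_sumr; apply: eq_bigr => i _; rewrite mulrA.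
Qed.

Lemma ideal_exp_ideal I n : ideal I -> ideal (ideal_exp I n).
Proof. by case: n => [|n] idI //=; apply: ideal_mul_ideal. Qed.

Lemma jacobson_ideal : ideal (@jacobson_radical R).
Proof.
split; first by move=> M [[M0 _ _] _ _].
  by move=> x y Jx Jy M hM; case: (hM) => -[_ MD _] _ _; apply: MD; [exact: Jx | exact: Jy].
by move=> a x Jx M hM; case: (hM) => -[_ _ MM] _ _; apply: MM; exact: Jx.
Qed.

End IdealLemmas.

Section Blowup.
Variables (Q : comNzRingType) (A : subring Q).

(* the ideal J(A)^i of A, as a subset of Q *)
Definition jacobson_pow (i : nat) : set Q :=
  [set val x | x in ideal_exp (@jacobson_radical A) i].

Definition blowup_set : set Q :=
  \bigcup_i colon (jacobson_pow i) (jacobson_pow i).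

Lemma colon_jacobson_pow_le i j : (i <= j)%N ->
  colon (jacobson_pow i) (jacobson_pow i) `<=`
  colon (jacobson_pow j) (jacobson_pow j).
Proof.
move=> /subnK <-; elim: (j - i)%N => // k IH a /IH {}IH; rewrite addSn.
move=> _ [_ [n [b [c [Jb Jc ->]]]] <-].
have Ec l : exists d : A, ideal_exp (@jacobson_radical A) (k + i)%N d /\
    val d = a * val (c l).
  have Jcl : jacobson_pow (k + i)%N (val (c l)).
    exists (c l); [exact: Jc | by []].
  by have [d Jd e] := IH _ Jcl; exists d.
have [d hd] := fin_all_exists Ec.
exists (\sum_l b l * d l).
  by exists n, b, d; split=> // l; case: (hd l).
rewrite [LHS](raddf_sum (val : A -> Q)) [X in _ = a * X](raddf_sum (val : A -> Q)).
rewrite mulr_sumr; apply: eq_bigr => l _.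
rewrite [LHS](rmorphM (val : A -> Q)) [X in _ = a * X](rmorphM (val : A -> Q)) /=.
by case: (hd l) => _ ->; rewrite mulrCA.
Qed.

Lemma blowup_subring_closed : GRing.subring_closed [in blowup_set].
Proof.
split.
- by apply/mem_set; exists 0%N => // y Jy; rewrite mul1r.
- move=> x y /set_mem[i _ xi] /set_mem[j _ yj]; apply/mem_set.
  exists (maxn i j) => // z Jz.
  have [u Ju e1] := colon_jacobson_pow_le (leq_maxl i j) xi Jz.
  have [v Jv e2] := colon_jacobson_pow_le (leq_maxr i j) yj Jz.
  exists (u - v); first by apply: idealB => //; apply/ideal_exp_ideal/jacobson_ideal.
  by rewrite [LHS](rmorphB (val : A -> Q)) /= e1 e2 mulrBl.
- move=> x y /set_mem[i _ xi] /set_mem[j _ yj]; apply/mem_set.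
  exists (maxn i j) => // z Jz; rewrite -mulrA.
  apply: (colon_jacobson_pow_le (leq_maxl i j) xi).
  exact: (colon_jacobson_pow_le (leq_maxr i j) yj).
Qed.

Definition blowup : subring Q := Subring blowup_subring_closed.

End Blowup.

Section ArfRings.
Variable R : comNzRingType.
Local Notation Q := (total_fractions R).

Lemma range_subring_closed : GRing.subring_closed [in range (to_total R)].
Proof.
split; first by apply/mem_set; exists 1; rewrite ?rmorph1.
- move=> x y /set_mem[a _ <-] /set_mem[b _ <-]; apply/mem_set.
  by exists (a - b); rewrite ?rmorphB.
- move=> x y /set_mem[a _ <-] /set_mem[b _ <-]; apply/mem_set.
  by exists (a * b); rewrite ?rmorphM.
Qed.

(* R_0 is the image of R in Q(R), and all colons are taken in Q(R), which is
   also the total ring of fractions of each R_n *)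
Fixpoint tower (n : nat) : subring Q :=
  if n is n'.+1 then blowup (tower n') else Subring range_subring_closed.

Definition arf : Prop :=
  forall (n : nat) (M : set (tower n)) (hM : maximal_ideal M),
    minimal_multiplicity (localization_at (maximal_prime hM)).

Definition integral_set : set Q := [set x | integralOver (to_total R) x].

Lemma integral_subring_closed : GRing.subring_closed [in integral_set].
Proof.
split; first by apply/mem_set/integral1.
- by move=> x y /set_mem hx /set_mem hy; apply/mem_set; exact: integral_sub hx hy.
- by move=> x y /set_mem hx /set_mem hy; apply/mem_set; exact: integral_mul hx hy.
Qed.

Definition integral_closure : subring Q := Subring integral_subring_closed.

Definition finite_integral_closure : Prop :=
  exists s : seq Q, subring_set integral_closure = span (to_total R) s.

Definition trace (M : lmodType R) : set R :=
  [set x | exists n (f : 'I_n -> {linear M -> R^o}) (y : 'I_n -> M),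
     x = \sum_i f i (y i)].

Definition trace_ideals : set (set R) :=
  [set I | exists M : lmodType R, I = trace M].

End ArfRings.

Arguments arf R : clear implicits.
Arguments integral_closure R : clear implicits.
Arguments finite_integral_closure R : clear implicits.
Arguments trace_ideals R : clear implicits.

(* Main.v *)
Require Import Defs.
From HB Require Import structures.
From mathcomp Require Import all_boot all_order all_algebra.
From mathcomp Require Import boolp classical_sets functions cardinality.
From mathcomp Require Import ring zify.

(** Write Q for the total ring of fractions of R, f : R -> Q for the canonical
    map and V for the integral closure of R.

    Since V is finite over R and local, it is a discrete valuation ring
    ([uniformizer_exists]). Indeed, a common denominator embeds the
    R-submodules of V into the ideals of R, so V is noetherian; every prime of V
    containing a regular element r of m lies over m because dim R = 1, hence is
    the maximal ideal of V, so some q outside of V multiplies that maximal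
    ideal into V; as q is not integral, the determinant trick shows that q is
    the inverse of a generator. Consequently all subrings between R and V, in
    particular the rings R_n of the tower, are local ([max_below_local]), and any
    set of elements of V has an element of least valuation ([minimal_val]).

    Let M be the maximal ideal of R_n and let a in M have least valuation. The
    submodules M ^ j / a ^ j of V increase, so they are stationary: a generates a
    reduction of M. Comparing the growth of the colengths of the powers of M with
    a chain made of the multiples by powers of a of a cotangent chain, minimal
    multiplicity gives M ^ 2 = a M ([minimal_multiplicity_reduction]), so that
    R_(n+1) = M / a. By induction on the valuation of x this gives the
    classical Arf condition in every R_n: if y and z lie in x V, then y z lies in
    x R_n ([arf_quotient]).

    Finally let I be the nonzero trace ideal of a module and let a = g(y) have
    least valuation k among the values of the linear forms on the module. For x
    in R of valuation at least k, the form x g / a has values in R by the Arf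
    condition and maps y to x; hence I consists of all elements of R of
    valuation at least k. If d is a regular element with d V inside R, the form
    d g / a also has values in R, so d is in I and k is at most the valuation
    of d. This leaves finitely many possibilities for I ([trace_cases]). *)

Set Implicit Arguments.
Unset Strict Implicit.
Unset Printing Implicit Defensive.

Import GRing.Theory.
Local Open Scope classical_set_scope.
Local Open Scope ring_scope.

(** * Ideals, maximal ideals and generators *)

Lemma ssubsetP T (X Y : set T) :
  X `<` Y <-> X `<=` Y /\ exists2 y, Y y & ~ X y.
Proof.
split=> [[XY nYX]|[XY [y Yy nXy]]]; last by split=> // /(_ y Yy).
split=> //; apply: contrapT => no; apply: nYX => y Yy.
by apply: contrapT => nXy; apply: no; exists y.
Qed.

Section Ideals.
Variable A : comNzRingType.
Implicit Types (I J M P S : set A) (s : seq A).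

Lemma ideal0 I : ideal I -> I 0. Proof. by case. Qed.

Lemma ideal_add I x y : ideal I -> I x -> I y -> I (x + y).
Proof. by case=> _ ID _; apply: ID. Qed.

Lemma ideal_mull I a x : ideal I -> I x -> I (a * x).
Proof. by case=> _ _; apply. Qed.

Lemma ideal_mulr I a x : ideal I -> I x -> I (x * a).
Proof. by move=> idI Ix; rewrite mulrC; apply: ideal_mull. Qed.

Lemma ideal_sum I n (F : 'I_n -> A) :
  ideal I -> (forall i, I (F i)) -> I (\sum_i F i).
Proof.
move=> idI IF; apply: (big_ind I) => // [|x y]; first exact: ideal0.
exact: ideal_add.
Qed.

Lemma ideal_setT : ideal (@setT A). Proof. by []. Qed.

Lemma ideal_set0 : ideal [set 0 : A].
Proof.
split=> // [x y -> ->|a x ->]; first by rewrite /= addr0.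
by rewrite /= mulr0.
Qed.

Definition ideal_adj I (y : A) : set A :=
  [set x | exists u b, I u /\ x = u + b * y].

Lemma ideal_adj_ideal I y : ideal I -> ideal (ideal_adj I y).
Proof.
move=> idI; split; first by exists 0, 0; rewrite mul0r addr0; split=> //; apply: ideal0.
  move=> _ _ [u [b [Iu ->]]] [v [c [Iv ->]]].
  by exists (u + v), (b + c); split; [apply: ideal_add | ring].
move=> r _ [u [b [Iu ->]]]; exists (r * u), (r * b).
by split; [apply: ideal_mull | ring].
Qed.

Lemma ideal_adj_sub I y : I `<=` ideal_adj I y.
Proof. by move=> x Ix; exists x, 0; rewrite mul0r addr0. Qed.

Lemma ideal_adj_mem I y : ideal I -> ideal_adj I y y.
Proof. by move=> idI; exists 0, 1; rewrite mul1r add0r; split=> //; apply: ideal0. Qed.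

Lemma exists_maximal_disjoint I S : ideal I -> I `&` S = set0 ->
  exists J, [/\ ideal J, I `<=` J, J `&` S = set0 &
    forall K, ideal K -> J `<=` K -> K `&` S = set0 -> K = J].
Proof.
move=> idI IS.
(* Adding I to every member of a chain keeps the union of the empty chain in P. *)
pose P J := ideal (J `|` I) /\ (J `|` I) `&` S = set0.
have [|J [[idJ JS] maxJ]] := @Zorn_bigcup _ P.
  move=> F FP Ftot; split; last first.
    apply/seteqP; split=> // x [[[J FJ Jx]|Ix] Sx].
      by have [_ <-] := FP _ FJ; split=> //; left.
    by rewrite -IS.
  have [[J0 FJ0]|noF] := pselect (exists J, F J); last first.
    suff -> : \bigcup_(X in F) X = set0 by rewrite set0U.
    by apply/seteqP; split=> // x [J FJ _]; case: noF; exists J.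
  have inJ x : (\bigcup_(X in F) X `|` I) x -> exists2 J, F J & (J `|` I) x.
    by case=> [[J FJ Jx]|Ix]; [exists J => //; left | exists J0 => //; right].
  have ofJ J x : F J -> (J `|` I) x -> (\bigcup_(X in F) X `|` I) x.
    by move=> FJ [Jx|Ix]; [left; exists J | right].
  split; first by right; apply: ideal0.
    move=> x y /inJ[J FJ Jx] /inJ[K FK Ky].
    have [JK|KJ] := Ftot _ _ FJ FK.
      apply: (ofJ K) => //; have [idK _] := FP _ FK; apply: ideal_add => //.
      by case: Jx => [/JK Kx|Ix]; [left | right].
    apply: (ofJ J) => //; have [idJ _] := FP _ FJ; apply: ideal_add => //.
    by case: Ky => [/KJ Jy|Iy]; [left | right].
  move=> a x /inJ[J FJ Jx]; apply: (ofJ J) => //.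
  by have [idJ _] := FP _ FJ; apply: ideal_mull.
exists (J `|` I); split=> // K idK JK KS.
have KI : K `|` I = K by apply: setUidl; apply: subset_trans JK; apply: subsetUr.
apply: contrapT => neqK; apply: (maxJ K); last by rewrite /P KI.
apply/ssubsetP; split=> [|]; first by apply: subset_trans JK; apply: subsetUl.
apply: contrapT => noK; apply: neqK; apply/seteqP; split=> // x Kx.
by apply: contrapT => nx; apply: noK; exists x => // Jx; apply: nx; left.
Qed.

Lemma exists_maximal_ideal I : ideal I -> ~ I 1 ->
  exists2 M, maximal_ideal M & I `<=` M.
Proof.
have dj1 (K : set A) : K `&` [set 1] = set0 <-> ~ K 1.
  split=> [K0 K1|K1]; first by have : (K `&` [set 1]) 1 by []; rewrite K0.
  by apply/seteqP; split=> // x [Kx x1]; apply: K1; rewrite -x1.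
move=> idI I1; have [J [idJ IJ /dj1 J1 maxJ]] :=
  exists_maximal_disjoint idI ((dj1 I).2 I1).
by exists J => //; split=> // K idK K1 JK; apply: maxJ => //; apply/dj1.
Qed.

Lemma local_ring_proper_sub M I : local_ring M -> ideal I -> ~ I 1 -> I `<=` M.
Proof.
by move=> [_ uM] idI I1; have [N /uM ->] := exists_maximal_ideal idI I1.
Qed.

Lemma local_ring_unit M x : local_ring M -> ~ M x -> exists y, x * y = 1.
Proof.
move=> locM nMx; have := ideal_adj_ideal x ideal_set0.
move=> /(local_ring_proper_sub locM); case: (pselect (ideal_adj [set 0] x 1)).
  by move=> [u [b [-> e]]] _; exists b; rewrite mulrC e add0r.
by move=> n1 /(_ n1)/(_ x (ideal_adj_mem _ ideal_set0)).
Qed.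

Lemma jacobson_local M : local_ring M -> @jacobson_radical A = M.
Proof.
move=> [maxM uM]; apply/seteqP; split=> [x|x Mx N /uM -> //].
by apply.
Qed.

Lemma ideal_gen_ideal s : ideal (ideal_gen s).
Proof.
split; first by exists (fun=> 0); rewrite big1 // => i _; rewrite mul0r.
  move=> _ _ [a ->] [b ->]; exists (fun i => a i + b i).
  by rewrite -big_split; apply: eq_bigr => i _; rewrite /= mulrDl.
move=> r _ [a ->]; exists (fun i => r * a i).
by rewrite mulr_sumr; apply: eq_bigr => i _; rewrite /= mulrA.
Qed.

Lemma ideal_gen_mem s x : x \in s -> ideal_gen s x.
Proof.
move=> sx; have hi : (index x s < size s)%N by rewrite index_mem.
exists (fun i => (i == Ordinal hi)%:R).
rewrite (bigD1 (Ordinal hi)) //= eqxx mul1r nth_index // big1 ?addr0 // => i.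
by move=> /negbTE ->; rewrite mul0r.
Qed.

Lemma ideal_gen_sub s I : ideal I -> (forall x, x \in s -> I x) -> ideal_gen s `<=` I.
Proof.
move=> idI sI _ [a ->]; apply: ideal_sum => // i.
by apply: ideal_mull => //; apply: sI; apply: mem_nth.
Qed.

Lemma ideal_mul_sub I J K : ideal K ->
  (forall x y, I x -> J y -> K (x * y)) -> ideal_mul I J `<=` K.
Proof.
by move=> idK IJK _ [n [a [b [Ia Jb ->]]]]; apply: ideal_sum => // i; apply: IJK.
Qed.

Lemma ideal_mul_mem I J x y : I x -> J y -> ideal_mul I J (x * y).
Proof.
by move=> Ix Jy; exists 1%N, (fun=> x), (fun=> y); split=> //; rewrite big_ord1.
Qed.

Lemma ideal_exp_mem M x n : M x -> ideal_exp M n (x ^+ n).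
Proof. by move=> Mx; elim: n => // n IH; rewrite exprS; apply: ideal_mul_mem. Qed.

(** * Chains of ideals and minimal multiplicity *)

(** A strictly increasing chain of ideals from the first ideal to the second
    one; the inductive form makes concatenation and rescaling one-step
    inductions. *)
Inductive ideal_chain : set A -> set A -> nat -> Prop :=
| ideal_chain_nil I : ideal I -> ideal_chain I I 0
| ideal_chain_cons I J K l :
    ideal I -> I `<` J -> ideal_chain J K l -> ideal_chain I K l.+1.

Lemma ideal_chain_cat I J K l l' :
  ideal_chain I J l -> ideal_chain J K l' -> ideal_chain I K (l + l').
Proof.
elim=> {I J l} // I J J' l idI IJ _ IH /IH.
exact: ideal_chain_cons.
Qed.

Lemma ideal_chain_length I J l n : quotient_length I n ->
  ideal_chain J setT l -> I `<=` J -> (l <= n)%N.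
Proof.
move=> [_ maxn] cJ IJ.
suff [p [cp _]] : exists p, chain (fun K => ideal K /\ I `<=` K) l p /\ p 0%N = J.
  exact: maxn cp.
move: IJ; elim: cJ => {J l} [J idJ|J J' K l idJ ltJ _ IH] IJ.
  by exists (fun=> J); split.
have [|p [[cp sp] p0]] := IH; first by apply: subset_trans IJ (properW ltJ).
exists (fun i => if i is i'.+1 then p i' else J); split=> //.
split; first by case=> [|i] // /cp.
by case=> [_|i] /=; [rewrite p0 | apply: sp].
Qed.

Definition scale (a : A) I : set A := [set a * x | x in I].

Lemma scale_ideal a I : ideal I -> ideal (scale a I).
Proof.
move=> idI; split; first by exists 0; rewrite ?mulr0 //; apply: ideal0.
  by move=> _ _ [x Ix <-] [y Iy <-]; exists (x + y); rewrite ?mulrDr //; apply: ideal_add.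
by move=> r _ [x Ix <-]; exists (r * x); [apply: ideal_mull | ring].
Qed.

Lemma ideal_chain_scale a I J l : GRing.lreg a ->
  ideal_chain I J l -> ideal_chain (scale a I) (scale a J) l.
Proof.
move=> rega; elim=> {I J l} [I idI|I J K l idI /ssubsetP[IJ [y Jy nIy]] _ IH].
  exact/ideal_chain_nil/scale_ideal.
apply: ideal_chain_cons IH; first exact: scale_ideal.
apply/ssubsetP; split=> [_ [x /IJ Jx <-]|]; first by exists x.
by exists (a * y); [exists y | case=> z Iz /rega zy; apply: nIy; rewrite -zy].
Qed.

Lemma ideal_chain_iter a I l n : GRing.lreg a -> ideal I ->
  ideal_chain (scale a I) I l -> ideal_chain (scale (a ^+ n) I) I (n * l).
Proof.
move=> rega idI c; elim: n => [|n IH].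
  have -> : scale (a ^+ 0) I = I.
    by rewrite expr0; apply/seteqP; split=> [_ [x Ix <-]|x Ix];
      [rewrite mul1r | exists x; rewrite ?mul1r].
  exact: ideal_chain_nil.
rewrite mulSn; apply: ideal_chain_cat IH.
have -> : scale (a ^+ n.+1) I = scale (a ^+ n) (scale a I).
  apply/seteqP; split=> [_ [x Ix <-]|_ [_ [x Ix <-] <-]].
    by exists (a * x); [exists x | rewrite mulrA -exprSr].
  by exists x => //; rewrite mulrA -exprSr.
by apply: ideal_chain_scale => //; apply: lregX.
Qed.

(** Adding the members of a minimal generating sequence of M one after the
    other to the square of M gives a strict chain: this is the cotangent space
    dimension count. If a step were not strict, the corresponding generator x
    would satisfy x - m x in the span of the others for some m in M, and 1 - m
    is invertible, so x would be superfluous. *)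
Lemma cotangent_chain M e : local_ring M -> embedding_dim M e ->
  ideal_chain (ideal_mul M M) M e.
Proof.
move=> locM [[s [Ms sz_s]] mins]; have [[idM M1 _] _] := locM.
have idMM : ideal (ideal_mul M M) by apply: ideal_mul_ideal.
pose K i := [set x | exists y z, [/\ ideal_mul M M y, ideal_gen (take i s) z & x = y + z]].
have idK i : ideal (K i).
  have idG := ideal_gen_ideal (take i s); split.
  - by exists 0, 0; rewrite addr0; split=> //; apply: ideal0.
  - move=> _ _ [y [z [My Gz ->]]] [u [v [Mu Gv ->]]].
    by exists (y + u), (z + v); split; [apply: ideal_add | apply: ideal_add | ring].
  - move=> r _ [y [z [My Gz ->]]].
    by exists (r * y), (r * z); split; [apply: ideal_mull | apply: ideal_mull | ring].
have GK i : ideal_gen (take i s) `<=` K i.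
  by move=> z Gz; exists 0, z; rewrite add0r; split=> //; apply: ideal0.
have MK i : ideal_mul M M `<=` K i.
  move=> y My; exists y, 0; rewrite addr0; split=> //; apply: ideal0.
  exact: ideal_gen_ideal.
have sM x : x \in s -> M x by rewrite Ms; apply: ideal_gen_mem.
have K0 : K 0%N = ideal_mul M M.
  apply/seteqP; split=> [_ [y [z [My Gz ->]]]|]; last exact: MK.
  have -> : z = 0 by move: Gz; rewrite take0; case=> c ->; rewrite big_ord0.
  by rewrite addr0.
have KE : K e = M.
  apply/seteqP; split=> [_ [y [z [My Gz ->]]]|x Mx].
    apply: ideal_add => //.
      by move: y My; apply: (ideal_mul_sub idM) => u v Mu _; apply: ideal_mulr.
    move: z Gz; rewrite -sz_s take_size; apply: ideal_gen_sub => //.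
  by apply: GK; rewrite -sz_s take_size -Ms.
have ltK i : (i < e)%N -> K i `<` K i.+1.
  move=> lt_ie; apply/ssubsetP; split.
    move=> _ [y [z [My Gz ->]]]; exists y, z; split=> //; move: z Gz.
    apply: ideal_gen_sub => [|x]; first exact: ideal_gen_ideal.
    by move=> xs; apply: ideal_gen_mem; rewrite (take_nth 0) ?sz_s // mem_rcons inE xs orbT.
  exists s`_i.
    by apply: GK; apply: ideal_gen_mem; rewrite (take_nth 0) ?sz_s // mem_rcons inE eqxx.
  case=> y [z [My Gz e_si]].
  pose s' := take i s ++ drop i.+1 s; pose G := ideal_gen s'.
  have idG : ideal G by apply: ideal_gen_ideal.
  have modG x : M x -> exists c, G (x - c * s`_i).
    pose B := [set x | exists c, G (x - c * s`_i)].
    have idB : ideal B.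
      split; first by exists 0; rewrite mul0r subr0; apply: ideal0.
        move=> u v [c Gu] [d Gv]; exists (c + d).
        rewrite (_ : _ - _ = (u - c * s`_i) + (v - d * s`_i)); [exact: ideal_add | ring].
      move=> r u [c Gu]; exists (r * c).
      by rewrite -mulrA -mulrBr; apply: ideal_mull.
    rewrite Ms; apply: (ideal_gen_sub idB) => u.
    rewrite -[in u \in s](cat_take_drop i s) (drop_nth 0) ?sz_s // mem_cat inE.
    rewrite orbCA => /orP[/eqP ->|us'].
      by exists 1; rewrite mul1r subrr; apply: ideal0.
    by exists 0; rewrite mul0r subr0; apply: ideal_gen_mem; rewrite mem_cat.
  have [c [Mc Gc]] : exists c, M c /\ G (s`_i - c * s`_i).
    have [c [Mc Gyc]] : exists c, M c /\ G (y - c * s`_i).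
      pose B := [set y | exists c, M c /\ G (y - c * s`_i)].
      have idB : ideal B.
        split; first by exists 0; rewrite mul0r subr0; split; apply: ideal0.
          move=> u v [c' [Mc' Gu]] [d [Md Gv]]; exists (c' + d).
          split; first exact: ideal_add.
          rewrite (_ : _ - _ = (u - c' * s`_i) + (v - d * s`_i)); [exact: ideal_add | ring].
        move=> r u [c' [Mc' Gu]]; exists (r * c'); split; first exact: ideal_mull.
        by rewrite -mulrA -mulrBr; apply: ideal_mull.
      move: y My {e_si}; apply: (ideal_mul_sub idB) => u v Mu /modG[c' Gc'].
      exists (u * c'); split; first exact: ideal_mulr.
      by rewrite -mulrA -mulrBr; apply: ideal_mull.
    exists c; split=> //; rewrite {1}e_si.
    rewrite (_ : _ - _ = (y - c * s`_i) + z); last by ring.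
    apply: ideal_add => //; move: z Gz {e_si}; apply: ideal_gen_sub => // x xs.
    by apply: ideal_gen_mem; rewrite mem_cat xs.
  have [|d cd1] := @local_ring_unit M (1 - c) locM.
    by move=> M1c; apply: M1; rewrite -(subrK c 1); apply: ideal_add.
  have Gsi : G s`_i.
    rewrite (_ : s`_i = d * (s`_i - c * s`_i)); first exact: ideal_mull.
    by rewrite -{2}[s`_i]mul1r -mulrBl mulrA [d * _]mulrC cd1 mul1r.
  have /mins : M = G.
    apply/seteqP; split.
      rewrite Ms; apply: ideal_gen_sub => // x.
      rewrite -[in x \in s](cat_take_drop i s) (drop_nth 0) ?sz_s // mem_cat inE.
      rewrite orbCA => /orP[/eqP -> //|xs'].
      by apply: ideal_gen_mem; rewrite mem_cat.
    apply: ideal_gen_sub => // x; rewrite mem_cat => /orP[|] xs; apply: sM.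
      exact: mem_take xs.
    exact: mem_drop xs.
  by rewrite size_cat size_take size_drop sz_s lt_ie; lia.
(* j counts the steps that remain from K i to M *)
suff : forall j i, (i + j = e)%N -> ideal_chain (K i) M j.
  by move=> chainK; rewrite -K0; apply: chainK.
elim=> [|j IH] i ij; first by rewrite addn0 in ij; rewrite ij KE; apply: ideal_chain_nil.
by apply: (@ideal_chain_cons (K i) (K i.+1) M j); [ | apply: ltK | apply: IH]; lia || exact: idK.
Qed.

(** If a M were strictly smaller than the square of M, prolonging the cotangent
    chain by this inclusion would give a chain of length e + 1 from a M to M.
    Its multiples by 1, a, ..., a ^ (n - 1) fit together to a chain of length
    n (e + 1) from a ^ n M to M. As a ^ n M contains M ^ (n + k), the colength
    of M ^ (n + k) would be at least n (e + 1); but it is n e + O(1) since the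
    multiplicity is e. *)
Lemma minimal_multiplicity_reduction a : minimal_multiplicity A ->
  GRing.lreg a ->
  forall M, local_ring M -> M a ->
  (exists k, forall n, ideal_exp M (n + k) `<=` scale (a ^+ n) M) ->
  forall x y, M x -> M y -> exists2 z, M z & x * y = a * z.
Proof.
move=> [M' [locM' [e [mult emb]]]] rega M locM Ma [k red].
have eM : M' = M by case: locM => _; apply; case: locM'.
rewrite {M'}eM in locM' mult emb; have [[idM M1 _] _] := locM.
suff MMa : ideal_mul M M `<=` scale a M.
  by move=> x y Mx My; have [|z Mz <-] := MMa (x * y); [apply: ideal_mul_mem | exists z].
apply: contrapT => nMMa.
have caM : ideal_chain (scale a M) M e.+1.
  apply: (@ideal_chain_cons _ (ideal_mul M M)); first exact: scale_ideal.
    apply/ssubsetP; split=> [_ [x Mx <-]|]; first exact: ideal_mul_mem.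
    apply: contrapT => no; apply: nMMa => x MMx; apply: contrapT => nax.
    by apply: no; exists x.
  exact: cotangent_chain.
have cM : ideal_chain M setT 1.
  apply: ideal_chain_cons (ideal_chain_nil ideal_setT) => //.
  by apply/ssubsetP; split=> //; exists 1.
have [c [N lenM]] := mult.
(* n >= e k + c gives n (e + 1) >= e (n + k) + c, and n >= N makes the formula for
   the colength valid; the last step, from M to A, makes the inequality strict *)
pose n := (N + e * k + `|c|)%N.
have [|l len le] := lenM (n + k)%N; first by rewrite /n; lia.
have cn := ideal_chain_cat (ideal_chain_iter n rega idM caM) cM.
have := ideal_chain_length len cn (red n); move: le; rewrite /n.
nia.
Qed.

End Ideals.

(** The reduction lemma is needed in a local ring A, whereas multiplicity is
    prescribed for the localization L of A at its maximal ideal, which is an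
    isomorphic ring. *)
Lemma minimal_multiplicity_transfer (A L : comNzRingType) (phi : {rmorphism A -> L})
    (M : set A) (a : A) :
  injective phi -> (forall y, exists x, phi x = y) -> minimal_multiplicity L ->
  local_ring M -> GRing.lreg a -> M a ->
  (exists k, forall n, ideal_exp M (n + k) `<=` scale (a ^+ n) M) ->
  forall x y, M x -> M y -> exists2 z, M z & x * y = a * z.
Proof.
move=> inj surj mmL locM rega Ma [k red] x y Mx My.
have [N [locN _]] := mmL; have [[idM M1 maxM] uM] := locM.
have [[idN N1 maxN] _] := locN.
have eM : M = phi @^-1` N.
  apply/esym/uM; split; last 2 first.
  - by rewrite /preimage /= rmorph1.
  - move=> J idJ J1 NJ; suff eN : N = phi @` J.
      apply/seteqP; split=> // u Ju; rewrite /preimage /= eN; by exists u.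
    apply/esym/maxN.
    + split; first by exists 0; [apply: ideal0 | rewrite rmorph0].
        move=> _ _ [u Ju <-] [v Jv <-]; exists (u + v); rewrite ?rmorphD //.
        exact: ideal_add.
      move=> r _ [u Ju <-]; have [r' <-] := surj r; exists (r' * u).
        exact: ideal_mull.
      by rewrite rmorphM.
    + by case=> u Ju; rewrite -(rmorph1 phi) => /inj u1; apply: J1; rewrite -u1.
    + by move=> v Nv; have [u uv] := surj v; exists u => //; apply: NJ; rewrite /preimage /= uv.
  split; first by rewrite /preimage /= rmorph0; apply: ideal0.
    by move=> u v; rewrite /preimage /= rmorphD; apply: ideal_add.
  by move=> r u; rewrite /preimage /= rmorphM; apply: ideal_mull.
have expN j v : ideal_exp N j v -> exists2 u, ideal_exp M j u & phi u = v.
  elim: j v => [|j IH] v; first by move=> _; have [u uv] := surj v; exists u.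
  move=> [n [b [c [Nb Nc ->]]]].
  have /fin_all_exists2[u Mu uE] i := IH _ (Nc i).
  have /fin_all_exists[b' b'E] i := surj (b i).
  exists (\sum_i b' i * u i).
    by exists n, b', u; split=> // i; rewrite eM /preimage /= b'E.
  by rewrite rmorph_sum; apply: eq_bigr => i _; rewrite rmorphM uE b'E.
have regpa : GRing.lreg (phi a).
  move=> u v; have [u' <-] := surj u; have [v' <-] := surj v.
  by rewrite -!rmorphM => /inj/rega ->.
have NE u : N (phi u) <-> M u by rewrite eM.
have [||z Nz e] := @minimal_multiplicity_reduction L (phi a) mmL regpa N locN _ _
  (phi x) (phi y) ((NE x).2 Mx) ((NE y).2 My).
- by apply/NE.
- exists k => n v /expN[u /red[w Mw <-] <-]; exists (phi w); first exact/NE.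
  by rewrite rmorphM rmorphXn.
have [z' z'z] := surj z; exists z'; first by apply/NE; rewrite z'z.
by apply: inj; rewrite !rmorphM z'z.
Qed.

(** * Subrings and chain conditions *)

Section SubringSet.
Variables (Q : comNzRingType) (A : subring Q).
Implicit Types x y : Q.

Let memE x : subring_set A x = (x \in subring_pred A) :> Prop.
Proof. by apply/propext; split=> [?|/set_mem //]; apply/mem_set. Qed.

Lemma subring_setM x y : subring_set A x -> subring_set A y -> subring_set A (x * y).
Proof. by rewrite !memE; apply: rpredM. Qed.
Lemma subring_setX x n : subring_set A x -> subring_set A (x ^+ n).
Proof. by rewrite !memE; apply: rpredX. Qed.
Lemma subring_set_sum n (F : 'I_n -> Q) :
  (forall i, subring_set A (F i)) -> subring_set A (\sum_i F i).
Proof. by move=> AF; rewrite memE; apply: rpred_sum => i _; rewrite -memE. Qed.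

Lemma subring_valP (x : A) : subring_set A (val x).
Proof. by rewrite memE; apply: valP. Qed.

Lemma subring_val0 : val (0 : A) = 0. Proof. exact: rmorph0. Qed.
Lemma subring_val1 : val (1 : A) = 1. Proof. exact: rmorph1. Qed.
Lemma subring_valD (x y : A) : val (x + y) = val x + val y. Proof. exact: rmorphD. Qed.
Lemma subring_valM (x y : A) : val (x * y) = val x * val y. Proof. exact: rmorphM. Qed.
Lemma subring_valX (x : A) n : val (x ^+ n) = val x ^+ n. Proof. exact: rmorphXn. Qed.

Lemma subring_lift x : subring_set A x -> exists u : A, val u = x.
Proof. by rewrite memE => Ax; exists (Sub x Ax); rewrite SubK. Qed.

End SubringSet.

Lemma noetherian_acc (A : comNzRingType) (I : nat -> set A) : noetherian A ->
  (forall n, ideal (I n)) -> (forall n, I n `<=` I n.+1) ->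
  exists k, forall j, I j `<=` I k.
Proof.
move=> noeA idI incI.
have monoI i j : (i <= j)%N -> I i `<=` I j.
  move=> /subnK <-; elim: (j - i)%N => // n IH; exact: subset_trans (incI _).
pose U := \bigcup_n I n.
have idU : ideal U.
  split; first by exists 0%N => //; apply: ideal0.
    move=> x y [i _ Ix] [j _ Iy]; exists (maxn i j) => //.
    by apply: ideal_add => //; [apply: (monoI i) | apply: (monoI j)]; rewrite // ?leq_maxl ?leq_maxr.
  by move=> a x [i _ Ix]; exists i => //; apply: ideal_mull.
have [s Us] := noeA U idU.
suff [k ks] : exists k, forall x, x \in s -> I k x.
  exists k => j x Ijx; have : U x by exists j.
  by rewrite Us; apply: ideal_gen_sub.
have sU x : x \in s -> U x by rewrite Us; apply: ideal_gen_mem.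
elim: s sU {Us} => [|y s IH] sU; first by exists 0%N.
have [|k ks] := IH; first by move=> x xs; apply: sU; rewrite inE xs orbT.
have [|j _ Ijy] := sU y; first by rewrite inE eqxx.
exists (maxn k j) => x; rewrite inE => /orP[/eqP ->|/ks].
  exact: (monoI j) (leq_maxr _ _) _ _.
exact: (monoI k) (leq_maxl _ _) _.
Qed.

Lemma acc_maximal T (P : set (set T)) :
  (forall N : nat -> set T, (forall n, P (N n)) -> (forall n, N n `<=` N n.+1) ->
     exists k, forall j, N j `<=` N k) ->
  forall N0, P N0 -> exists2 N, P N & forall N', P N' -> N `<=` N' -> N' = N.
Proof.
move=> acc N0 PN0; apply: contrapT => nomax.
have step N : exists N', P N -> P N' /\ N `<` N'.
  have [PN|nPN] := pselect (P N); last by exists N.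
  apply: contrapT => no; apply: nomax; exists N => // N' PN' NN'.
  apply: contrapT => ne; apply: no; exists N' => _; split=> //.
  by split=> // N'N; apply: ne; apply/seteqP.
have [g gP] := choice step.
have Pg n : P (iter n g N0) by elim: n => //= n IH; case: (gP _ IH).
have [n|k kP] := acc (fun n => iter n g N0) Pg.
  by have [_ []] := gP _ (Pg n).
by have [_ [_]] := gP _ (Pg k); apply; apply: (kP k.+1).
Qed.

(** * The total ring of fractions and its finite submodules *)

Section FractionRings.
Variables (R Q : comNzRingType) (f : {rmorphism R -> Q}).

Definition fraction_ring : Prop :=
  [/\ injective f, forall s, GRing.lreg s -> exists q, f s * q = 1 &
    forall q, exists a s, GRing.lreg s /\ f s * q = f a].

Definition integral_elements : set Q := [set x | integralOver f x].

End FractionRings.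

Section TotalFractions.
Variable R : comNzRingType.
Local Notation f := (to_total R).

Lemma to_total_inj : injective f.
Proof. by move=> a b /frac_eqP[u regu]; rewrite !mulr1 => /regu. Qed.

Lemma total_den (q : total_fractions R) : exists a s, GRing.lreg s /\ f s * q = f a.
Proof.
have [a [s [hs ->]]] := fracP q; exists a, s; split=> //.
rewrite [LHS](_ : _ = loc_mul (f s) (Defs.frac a hs)) // loc_mulE.
by apply/frac_eqP; exists 1; [exact: mul_subset1 | ring].
Qed.

Lemma lreg_total_inv s : GRing.lreg s -> exists q, f s * q = 1.
Proof.
move=> regs; exists (@Defs.frac _ (nonzerodivisors R) 1 s regs).
rewrite [LHS](_ : _ = loc_mul (f s) (@Defs.frac _ (nonzerodivisors R) 1 s regs)) //.
by rewrite loc_mulE; apply/frac_eqP; exists 1; [exact: mul_subset1 | ring].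
Qed.

Lemma total_fraction_ring : fraction_ring f.
Proof. by split; [exact: to_total_inj | exact: lreg_total_inv | exact: total_den]. Qed.

End TotalFractions.

Lemma lreg_of_inv (S : comNzRingType) (x y : S) : x * y = 1 -> GRing.lreg x.
Proof. by move=> xy u v e; rewrite -[u]mul1r -[v]mul1r -xy mulrAC e mulrAC. Qed.

Section Integral.
Variables (R Q : comNzRingType) (f : {rmorphism R -> Q}).
Local Notation V := (integral_elements f).
Implicit Types (x y q : Q) (N : set Q).

Lemma closure0 : V 0. Proof. exact: integral0. Qed.
Lemma closure1 : V 1. Proof. exact: integral1. Qed.
Lemma closureD x y : V x -> V y -> V (x + y). Proof. exact: integral_add. Qed.
Lemma closureB x y : V x -> V y -> V (x - y). Proof. exact: integral_sub. Qed.
Lemma closureM x y : V x -> V y -> V (x * y). Proof. exact: integral_mul. Qed.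
Lemma closure_total r : V (f r). Proof. exact: integral_id. Qed.
Lemma closureX x n : V x -> V (x ^+ n).
Proof.
by move=> Vx; elim: n => [|n IH]; [exact: closure1 | rewrite exprS; apply: closureM].
Qed.

Definition submodule N : Prop :=
  [/\ N 0, forall x y, N x -> N y -> N (x + y) & forall r x, N x -> N (f r * x)].

Lemma common_denominator : fraction_ring f -> (exists s, V = Defs.span f s) ->
  exists d, GRing.lreg d /\ forall x, V x -> range f (f d * x).
Proof.
move=> [_ _ denf] [s Vs].
suff [d [regd ds]] : exists d, GRing.lreg d /\ forall x, x \in s -> range f (f d * x).
  exists d; split=> // x; rewrite Vs => -[a ->].
  have /fin_all_exists[b bE] (i : 'I_(size s)) : exists b, f b = f d * s`_i.
    by have [|b _ be] := ds s`_i; [exact: mem_nth | exists b].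
  exists (\sum_i a i * b i) => //.
  rewrite rmorph_sum mulr_sumr; apply: eq_bigr => i _.
  by rewrite rmorphM bE mulrCA.
elim: s {Vs} => [|q s [d [regd ds]]]; first by exists 1; split=> //; apply: lreg1.
have [a [t [regt te]]] := denf q.
exists (t * d); split=> [|x]; first exact: lregM.
rewrite inE => /orP[/eqP ->|/ds[b _ be]].
  by exists (d * a) => //; rewrite !rmorphM mulrAC te mulrC.
by exists (t * b) => //; rewrite !rmorphM -mulrA be.
Qed.

(** When the integral closure V is finite, a common denominator d embeds
    its submodules into the ideals of R. *)
Section Finite.
Hypothesis noeR : noetherian R.
Hypothesis fracf : fraction_ring f.
Hypothesis finV : exists s, V = Defs.span f s.

Let lreg_inv s : GRing.lreg s -> exists q, f s * q = 1.
Proof. by case: fracf => _ + _; apply. Qed.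

Let scaled_ideal d N : set R := [set x | exists2 y, N y & f x = f d * y].

Let scaled_idealP d N : submodule N -> ideal (scaled_ideal d N).
Proof.
move=> [N0 ND NM]; split; first by exists 0; rewrite // rmorph0 mulr0.
  move=> x y [u Nu e] [v Nv e']; exists (u + v); first exact: ND.
  by rewrite rmorphD e e' mulrDr.
move=> a x [u Nu e]; exists (f a * u); first exact: NM.
by rewrite rmorphM e mulrCA.
Qed.

Lemma submodule_acc (N : nat -> set Q) : (forall n, submodule (N n)) ->
  (forall n, N n `<=` V) -> (forall n, N n `<=` N n.+1) ->
  exists k, forall j, N j `<=` N k.
Proof.
move=> subN NV incN; have [d [regd dV]] := common_denominator fracf finV.
have [q dq] := lreg_inv regd.
have [||k kP] := @noetherian_acc R (fun n => scaled_ideal d (N n)) noeR.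
- by move=> n; apply: scaled_idealP.
- by move=> n x [y /incN Ny e]; exists y.
exists k => j y Ny; have [x _ xe] := dV y (NV _ _ Ny).
by have [|z Nz] := kP j x; [exists y | rewrite xe => /(lreg_of_inv dq) ->].
Qed.

Lemma submodule_fg N : submodule N -> N `<=` V ->
  exists n (X : 'I_n -> Q), (forall i, N (X i)) /\
    forall y, N y -> exists a : 'I_n -> R, y = \sum_i f (a i) * X i.
Proof.
move=> subN NV; have [d [regd dV]] := common_denominator fracf finV.
have [q dq] := lreg_inv regd; have [s Is] := noeR (scaled_idealP d subN).
have /fin_all_exists2[X NX XE] (i : 'I_(size s)) : exists2 y, N y & f s`_i = f d * y.
  have : ideal_gen s s`_i by apply/ideal_gen_mem/mem_nth.
  by rewrite -Is.
exists (size s), X; split=> // y Ny.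
have [x _ xe] := dV y (NV _ Ny).
have : ideal_gen s x by rewrite -Is; exists y.
case=> a ax; exists a; apply: (lreg_of_inv dq); rewrite -xe ax rmorph_sum mulr_sumr.
by apply: eq_bigr => i _; rewrite /= rmorphM XE mulrCA.
Qed.

(** The determinant trick: the characteristic polynomial of the matrix of
    multiplication by q on generators of N annihilates N, hence the unit w. *)
Lemma integral_of_stable N q w w' : submodule N -> N `<=` V -> N w -> w * w' = 1 ->
  (forall x, N x -> N (q * x)) -> V q.
Proof.
move=> subN NV Nw ww' qN; have [n [X [NX genX]]] := submodule_fg subN NV.
have /fin_all_exists[r rE] i := genX _ (qN _ (NX i)).
pose A := \matrix_(i, j) r i j; pose B := q%:M - map_mx f A.
pose C := \col_i X i.
have BC0 : B *m C = 0.
  apply/eqP; rewrite mulmxBl mul_scalar_mx subr_eq0; apply/eqP/colP => i.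
  by rewrite !mxE rE; apply: eq_bigr => j _; rewrite !mxE.
have detX i : \det B * X i = 0.
  have /colP/(_ i) : \det B *: C = 0.
    by rewrite -mul_scalar_mx -mul_adj_mx -mulmxA BC0 mulmx0.
  by rewrite !mxE.
have det0 : \det B = 0.
  have [a wE] := genX _ Nw.
  rewrite -[\det B]mulr1 -ww' wE mulr_suml mulr_sumr big1 // => i _.
  by rewrite [f _ * _]mulrC !mulrA detX !mul0r.
exists (char_poly A); first exact: char_poly_monic.
rewrite rootE -horner_evalE -2!det_map_mx -det0; apply/eqP; congr (\det _).
rewrite raddfB/= map_scalar_mx; apply/matrixP=> i j.
by rewrite !mxE raddfB raddfMn/= map_polyX map_polyC /horner_eval !hornerE.
Qed.

End Finite.

(** An integral equation of y of degree n + 1, multiplied by x ^ n. *)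
Lemma integral_inv_poly x y : fraction_ring f -> V y -> x * y = 1 ->
  exists g : {poly R}, y = (map_poly f g).[x].
Proof.
move=> [injf _ _] [p monp /rootP py] xy.
have sz_p : size (map_poly f p) = size p by rewrite size_map_inj_poly ?rmorph0.
have xyX i k : (i <= k)%N -> x ^+ k * y ^+ i = x ^+ (k - i).
  by move=> ik; rewrite -{1}(subnK ik) exprD -mulrA -exprMn xy expr1n mulr1.
case sz: (size p) => [|n].
  by move: monp; rewrite monicE lead_coefE sz nth_default ?sz // eq_sym oner_eq0.
move: py; rewrite horner_coef sz_p sz big_ord_recr /= !coef_map /=.
have -> : p`_n = 1 by have := monicP monp; rewrite lead_coefE sz.
rewrite rmorph1 mul1r => /(congr1 (fun z => x ^+ n.-1 * z)); rewrite mulr0 mulrDr.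
case: n sz => [|n] sz /=.
  by rewrite big_ord0 mulr0 add0r expr0 mulr1 => /eqP; rewrite oner_eq0.
have -> : x ^+ n * y ^+ n.+1 = y by rewrite exprSr mulrA xyX // subnn mul1r.
move=> /eqP; rewrite addrC addr_eq0 => /eqP yE.
exists (\sum_(i < n.+1) (- p`_i)%:P * 'X^(n - i)).
rewrite {1}yE -mulrN -sumrN mulr_sumr rmorph_sum horner_sum; apply: eq_bigr => i _.
rewrite rmorphM /= map_polyC map_polyXn hornerCM hornerXn coef_map -mulNr mulrCA.
rewrite xyX; last by have := ltn_ord i; rewrite ltnS.
by congr (_ * _); rewrite -(rmorphN f).
Qed.

(** A non-unit of R stays a non-unit in V. *)
Lemma integral_inv_total c y : fraction_ring f -> V y -> f c * y = 1 ->
  exists d, c * d = 1.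
Proof.
move=> fracf Vy cy; have [g yg] := integral_inv_poly fracf Vy cy.
case: fracf => injf _ _; exists g.[c]; apply: injf.
by rewrite rmorphM -horner_map -yg cy rmorph1.
Qed.

Lemma integral_inv_mem (A : subring Q) x y : fraction_ring f ->
  range f `<=` subring_set A -> subring_set A x -> V y -> x * y = 1 -> subring_set A y.
Proof.
move=> fracf RA Ax Vy xy; have [g ->] := integral_inv_poly fracf Vy xy.
rewrite horner_coef; apply: subring_set_sum => i.
apply: subring_setM; first by apply: RA; rewrite coef_map; exists g`_i.
exact: subring_setX.
Qed.

End Integral.

(** * The integral closure is a discrete valuation ring *)

Lemma maximal_disjoint_prime (A : comNzRingType) (S J : set A) : S 1 ->
  (forall x y, S x -> S y -> S (x * y)) -> ideal J -> J `&` S = set0 ->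
  (forall K, ideal K -> J `<=` K -> K `&` S = set0 -> K = J) -> prime_ideal J.
Proof.
move=> S1 SM idJ JS maxJ.
have nJS x : J x -> S x -> False by move=> Jx Sx; suff : set0 x by []; rewrite -JS.
split=> // [J1|x y Jxy]; first exact: nJS S1.
have meet z : ~ J z -> exists u b, J u /\ S (u + b * z).
  move=> nJz; apply: contrapT => no; apply: nJz.
  rewrite -(maxJ _ (ideal_adj_ideal z idJ)); first exact: ideal_adj_mem.
    exact: ideal_adj_sub.
  apply/seteqP; split=> // _ [[u [b [Ju ->]]] Sub].
  by apply: no; exists u, b.
apply: contrapT => /not_orP[/meet[u [b [Ju Sx]]] /meet[v [c [Jv Sy]]]].
apply: (nJS _ _ (SM _ _ Sx Sy)).
rewrite (_ : _ * _ = (v + c * y) * u + ((b * x) * v + (b * c) * (x * y))); last by ring.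
by do 2?[apply: ideal_add => //]; apply: ideal_mull.
Qed.

(** A prime P containing a regular element r is not minimal: no product r ^ i s
    with s outside of P vanishes, so some prime avoids all these products; it
    lies in P and does not contain r. *)
Lemma dim1_regular_prime (R : comNzRingType) (m P : set R) (r : R) :
  local_ring m -> krull_dim R 1 -> GRing.lreg r -> prime_ideal P -> P r -> P = m.
Proof.
move=> locm [_ dim1] regr primeP Pr; have [idP P1 Pxy] := primeP.
pose S := [set x | exists i s, ~ P s /\ x = r ^+ i * s].
have S1 : S 1 by exists 0%N, 1; rewrite mulr1.
have SM x y : S x -> S y -> S (x * y).
  move=> [i [s [nPs ->]]] [j [t [nPt ->]]]; exists (i + j)%N, (s * t).
  by split; [case/Pxy | rewrite exprD; ring].
have S0 : [set 0] `&` S = set0.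
  apply/seteqP; split=> // x [-> [i [s [nPs /esym]]]].
  rewrite -[RHS](mulr0 (r ^+ i)) => /(lregX regr) s0; apply: nPs.
  by rewrite s0; apply: ideal0.
have [J [idJ _ JS maxJ]] := exists_maximal_disjoint (@ideal_set0 R) S0.
have primeJ := maximal_disjoint_prime S1 SM idJ JS maxJ.
have nJS x : J x -> S x -> False by move=> Jx Sx; suff : set0 x by []; rewrite -JS.
have JP : J `<` P.
  apply/ssubsetP; split=> [x Jx|].
    apply: contrapT => nPx; apply: (nJS _ Jx).
    by exists 0%N, x; rewrite mul1r.
  by exists r => // Jr; apply: (nJS _ Jr); exists 1%N, 1; rewrite mulr1.
have Pm := local_ring_proper_sub locm idP P1.
apply: contrapT => neqP.
have ltPm : P `<` m by split=> // mP; apply: neqP; apply/seteqP.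
have primem : prime_ideal m by case: locm => maxm _; exact: maximal_prime.
suff : (2 <= 1)%N by [].
apply: (dim1 _ (fun i => if i is 0 then J else if i is 1 then P else m)).
by split=> [[|[|[|i]]]|[|[|i]]].
Qed.

Section Closure.
Variables (R Q : comNzRingType) (f : {rmorphism R -> Q}).
Local Notation V := (integral_elements f).
Implicit Types (x y q : Q).

(** V is a discrete valuation ring with uniformizer p, and p' = 1 / p. An
    invertible element of Q is carried along with its inverse, and p' x in V
    says that x has positive valuation. The last clause says that the powers of
    p V intersect in 0. *)
Definition uniformizer (p p' : Q) : Prop :=
  [/\ V p, p * p' = 1, ~ V p',
    forall x, V x -> V (p' * x) \/ exists2 y, V y & x * y = 1 &
    forall x, (forall k, V (p' ^+ k * x)) -> x = 0].

Section Existence.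
Variables (m : set R) (r : R) (B : subring Q) (n : set B).
Hypotheses (noeR : noetherian R) (locR : local_ring m) (dimR : krull_dim R 1).
Hypotheses (mr : m r) (regr : GRing.lreg r).
Hypotheses (fracf : fraction_ring f) (finV : exists s, V = Defs.span f s).
Hypotheses (BV : subring_set B = V) (locn : local_ring n).

Let maxV : set Q := [set val x | x in n].

Let idn : ideal n. Proof. by case: locn => -[]. Qed.

Let maxV_sub x : maxV x -> V x.
Proof. by move=> [u _ <-]; rewrite -BV; exact: subring_valP. Qed.

Let maxV_unit x : V x -> ~ maxV x -> exists2 y, V y & x * y = 1.
Proof.
rewrite -BV => /subring_lift[u <-] nmx; have [|w uw] := @local_ring_unit _ n u locn.
  by move=> nu; apply: nmx; exists u.
by exists (val w); [exact: subring_valP | rewrite -rmorphM uw rmorph1].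
Qed.

Let maxV_D x y : maxV x -> maxV y -> maxV (x + y).
Proof.
by move=> [u nu <-] [w nw <-]; exists (u + w); [apply: ideal_add | rewrite rmorphD].
Qed.

Let maxV_M x y : V x -> maxV y -> maxV (x * y).
Proof.
rewrite -BV => /subring_lift[u <-] [w nw <-].
by exists (u * w); [apply: ideal_mull | rewrite rmorphM].
Qed.

Let maxV_N x : maxV x -> maxV (- x).
Proof.
move=> [u nu <-]; exists (- u); last by rewrite rmorphN.
by rewrite -mulN1r; apply: ideal_mull.
Qed.

Let maxV_1 : ~ maxV 1.
Proof.
move=> [u nu u1]; have [[_ n1 _] _] := locn; apply: n1.
by rewrite (_ : 1 = u) //; apply: val_inj; rewrite u1 rmorph1.
Qed.

Let maxV_0 : maxV 0.
Proof. by exists 0; [apply: ideal0 | rewrite rmorph0]. Qed.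

Let maxV_total c : maxV (f c) <-> m c.
Proof.
have [[idm m1 _] _] := locR.
split=> [mc|mc]; apply: contrapT => no.
  have [d cd] := local_ring_unit locR no.
  by apply: maxV_1; rewrite -(rmorph1 f) -cd rmorphM mulrC; apply: maxV_M => //; apply: closure_total.
have [y Vy cy] := maxV_unit (closure_total f c) no.
have [d cd] := integral_inv_total fracf Vy cy.
by apply: m1; rewrite -cd; apply: ideal_mulr.
Qed.

(** A prime of V lying over m contains every element y of the maximal ideal:
    remove, one after the other, the constant terms of an integral equation of
    y, which lie in m, and divide by y. *)
Let lying_over (P : set Q) y : P `<=` maxV ->
  P 0 -> (forall x z, P x -> P z -> P (x - z)) ->
  (forall x z, V x -> V z -> P (x * z) -> P x \/ P z) ->
  (forall c, m c -> P (f c)) -> maxV y -> P y.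
Proof.
move=> PmaxV P0 PB Pxy Pm my; have Vy := maxV_sub my.
have [g mong /rootP gy] := Vy.
have : P (map_poly f g).[y] by rewrite gy.
elim/poly_ind: g mong {gy} => [|g c IH mong].
  by rewrite monicE lead_coef0 eq_sym oner_eq0.
rewrite rmorphD rmorphM /= map_polyX map_polyC hornerMXaddC => Pg.
have Vgy : V (map_poly f g).[y].
  rewrite horner_coef; apply: (big_ind V) => [|u v|i _].
  - exact: closure0.
  - exact: closureD.
  - by rewrite coef_map; apply: closureM; [apply: closure_total | apply: closureX].
have mc : m c.
  apply/maxV_total; rewrite -[f c](addKr ((map_poly f g).[y] * y)) /=.
  apply: maxV_D; last exact: PmaxV.
  by apply: maxV_N; apply: maxV_M.
have : P ((map_poly f g).[y] * y).
  by rewrite -[_ * y](addrK (f c)); apply: PB => //; apply: Pm.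
case/(Pxy _ _ Vgy Vy) => //; apply: IH.
have [g0|gn0] := eqVneq g 0.
  case: maxV_1; apply: PmaxV; move: Pg mong.
  rewrite g0 rmorph0 horner0 !mul0r !add0r monicE lead_coefC => + /eqP c1.
  by rewrite c1 -(rmorph1 f).
move: mong; rewrite !monicE lead_coefDl ?lead_coefMX //.
by rewrite size_polyC size_mulX // (leq_ltn_trans (leq_b1 _)) // ltnS size_poly_gt0.
Qed.

(** Among the ideals D q = (V : q) with q in (1 / r) V outside of V, a maximal one
    is prime and contains r, so it lies over m and is the maximal ideal. *)
Let inverse_maxV : exists2 q, ~ V q & forall x, maxV x -> V (q * x).
Proof.
pose D q := [set x | V x /\ V (q * x)].
pose F := [set N | exists q, [/\ ~ V q, V (f r * q) & N = D q]].
have accF (N : nat -> set Q) : (forall k, F (N k)) -> (forall k, N k `<=` N k.+1) ->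
    exists k, forall j, N j `<=` N k.
  move=> FN incN; apply: (submodule_acc noeR fracf finV) => // k; have [q [_ _ ->]] := FN k; last by move=> x [].
  split; first by split; [|rewrite mulr0]; apply: closure0.
    move=> x y [Vx Vqx] [Vy Vqy]; split; first exact: closureD.
    by rewrite mulrDr; apply: closureD.
  move=> c x [Vx Vqx]; split; first exact: (closureM (closure_total f c) Vx).
  by rewrite mulrCA; exact: (closureM (closure_total f c) Vqx).
have [r' rr'] : exists r', f r * r' = 1 by case: fracf => _ + _; apply.
have nV x y : maxV x -> x * y = 1 -> ~ V y.
  by move=> mx xy Vy; apply: maxV_1; rewrite -xy mulrC; apply: maxV_M.
have FD : F (D r').
  by exists r'; split=> //; [apply: (nV (f r)) => //; apply/maxV_total | rewrite rr'; apply: closure1].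
have [_ [q [nVq Vrq ->]] maxD] := acc_maximal accF FD.
exists q => // y my; suff : D q y by case.
have DmaxV : D q `<=` maxV.
  move=> x [Vx Vqx]; apply: contrapT => /(maxV_unit Vx)[z Vz xz]; apply: nVq.
  by rewrite -[q]mulr1 -xz mulrA; apply: closureM.
have Dxy x z : V x -> V z -> D q (x * z) -> D q x \/ D q z.
  move=> Vx Vz [_ Vqxz]; have [Vqz|nVqz] := pselect (V (q * z)); first by right.
  left; suff <- : D (q * z) = D q.
    by split; [exact: Vx | rewrite -mulrA [z * x]mulrC; exact: Vqxz].
  apply: maxD => [|w [Vw Vqw]].
    exists (q * z); split; [exact: nVqz | | by []].
    by rewrite mulrA; exact: (closureM Vrq Vz).
  by split; [exact: Vw | rewrite mulrAC; exact: (closureM Vqw Vz)].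
have DB x z : D q x -> D q z -> D q (x - z).
  move=> [Vx Vqx] [Vz Vqz]; split; first exact: closureB.
  by rewrite mulrBr; exact: (closureB Vqx Vqz).
have D0 : D q 0 by split; [|rewrite mulr0]; apply: closure0.
have DM x z : V x -> D q z -> D q (x * z).
  move=> Vx [Vz Vqz]; split; first exact: (closureM Vx Vz).
  by rewrite mulrCA; exact: (closureM Vx Vqz).
apply: (lying_over DmaxV) => // c mc.
suff eP : f @^-1` (D q) = m by move: mc; rewrite -eP.
apply: (dim1_regular_prime locR dimR regr); last first.
  by split; [exact: closure_total | rewrite mulrC].
split.
- split; first by rewrite /preimage /= rmorph0.
    move=> u v Du Dv; rewrite /preimage /= rmorphD -[f v]opprK; apply: (DB) => //.
    by rewrite -sub0r; apply: DB.
  by move=> u v Dv; rewrite /preimage /= rmorphM; apply: DM => //; apply: closure_total.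
- by rewrite /preimage /= rmorph1 => /DmaxV/maxV_1.
- by move=> u v; rewrite /preimage /= rmorphM; apply: Dxy; apply: closure_total.
Qed.

(** With q as above, q maxV is an ideal of V; it is not contained in maxV, for q
    would be integral by the determinant trick. Hence q is the inverse of an
    element p of maxV, which then generates maxV. The powers of p V intersect in
    0: if x_k = x / p ^ k is in V for all k, the ascending chain of the
    R-submodules spanned by x_0, ..., x_k is stationary, so
    x_(k+1) = w p x_(k+1) for some k and w in V, and 1 - w p is a unit. *)
Lemma uniformizer_exists : exists p p', uniformizer p p'.
Proof.
have [q nVq qmaxV] := inverse_maxV.
have [r' rr'] : exists r', f r * r' = 1 by case: fracf => _ + _; apply.
have [p [mp qp]] : exists p, maxV p /\ q * p = 1.
  apply: contrapT => no; apply: nVq.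
  apply: (@integral_of_stable _ _ f noeR fracf finV maxV q (f r) r') => //.
  - by split=> // c x; apply: maxV_M; apply: closure_total.
  - by apply/maxV_total.
  - move=> x mx; apply: contrapT => /(maxV_unit (qmaxV _ mx))[y Vy qxy].
    by apply: no; exists (y * x); split; [apply: maxV_M | rewrite mulrCA mulrC].
exists p, q; split=> //; first exact: maxV_sub.
- by rewrite mulrC.
- move=> x Vx; have [mx|/(maxV_unit Vx)] := pselect (maxV x); [left; exact: qmaxV | by right].
move=> x Vx.
pose N k := [set y | exists2 a : 'I_k.+1 -> R, true & y = \sum_i f (a i) * (q ^+ i * x)].
have [| | |k kP] := submodule_acc noeR fracf finV (N := N).
- move=> k; split; first by exists (fun=> 0); rewrite // big1 // => i _; rewrite rmorph0 mul0r.
    move=> _ _ [a _ ->] [b _ ->]; exists (fun i => a i + b i) => //.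
    by rewrite -big_split; apply: eq_bigr => i _; rewrite rmorphD mulrDl.
  move=> c _ [a _ ->]; exists (fun i => c * a i) => //.
  by rewrite mulr_sumr; apply: eq_bigr => i _; rewrite rmorphM mulrA.
- move=> k _ [a _ ->]; apply: (big_ind V) => [|y z|i _]; first exact: closure0.
    exact: closureD.
  by apply: closureM; [apply: closure_total | apply: Vx].
- move=> k _ [a _ ->].
  exists (fun i : 'I_k.+2 => if insub (val i) is Some j then a j else 0) => //.
  rewrite [RHS]big_ord_recr /= insubF ?ltnn // rmorph0 mul0r addr0.
  by apply: eq_bigr => i _; rewrite (_ : insub _ = Some i) //; exact: valK.
have [a _ xE] : N k (q ^+ k.+1 * x).
  apply: (kP k.+1); exists (fun i => (i == ord_max)%:R) => //.
  rewrite (bigD1 ord_max) //= eqxx rmorph1 mul1r big1 ?addr0 // => i /negbTE ->.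
  by rewrite rmorph0 mul0r.
pose w := \sum_(i < k.+1) f (a i) * p ^+ (k - i).
have Vw : V w.
  apply: (big_ind V) => [|y z|i _]; [exact: closure0 | exact: closureD |].
  by apply: closureM; [apply: closure_total | apply: closureX; apply: maxV_sub].
have qX i j : (i <= j)%N -> p ^+ i * q ^+ j = q ^+ (j - i).
  by move=> ij; rewrite -{1}(subnK ij) exprD mulrCA -exprMn [p * q]mulrC qp expr1n mulr1.
have e : (1 - w * p) * (q ^+ k.+1 * x) = 0.
  rewrite mulrBl mul1r; apply/eqP; rewrite subr_eq0; apply/eqP.
  rewrite {1}xE !mulr_suml; apply: eq_bigr => i _.
  rewrite -!mulrA; congr (_ * _); rewrite !mulrA -exprSr qX; last by rewrite ltnS leq_subr.
  by congr (q ^+ _ * _); have := ltn_ord i; lia.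
have [||y Vy ey] := @maxV_unit (1 - w * p).
- by apply: closureB; [exact: closure1 | apply: closureM => //; apply: maxV_sub].
- move=> m1; apply: maxV_1; rewrite -(subrK (w * p) 1).
  by apply: maxV_D => //; apply: maxV_M.
have : q ^+ k.+1 * x = 0 by apply: (lreg_of_inv ey); rewrite e mulr0.
move/(congr1 (fun z => p ^+ k.+1 * z)); rewrite mulr0 mulrA qX // subnn mul1r.
by [].
Qed.

End Existence.
End Closure.

(** * Valuations and the rings of the tower *)

Section Tower.
Variables (R Q : comNzRingType) (f : {rmorphism R -> Q}).
Local Notation V := (integral_elements f).

Hypothesis fracf : fraction_ring f.
Variables (p p' : Q) (p_unif : uniformizer f p p').

Let Vp : V p. Proof. by case: p_unif. Qed.
Let pp' : p * p' = 1. Proof. by case: p_unif. Qed.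
Let nVp' : ~ V p'. Proof. by case: p_unif. Qed.

Let pX k l x : (k <= l)%N -> p ^+ k * (p' ^+ l * x) = p' ^+ (l - k) * x.
Proof.
by move=> kl; rewrite -{1}(subnK kl) exprD mulrA mulrCA -exprMn pp' expr1n mulr1.
Qed.

Lemma unit_or_maximal x : V x -> V (p' * x) \/ exists2 y, V y & x * y = 1.
Proof. by case: p_unif => _ _ _ unitV _; apply: unitV. Qed.

Lemma unit_nmaximal x y : x * y = 1 -> V y -> ~ V (p' * x).
Proof.
by move=> xy Vy Vpx; apply: nVp'; rewrite -[p']mulr1 -xy mulrA; apply: closureM.
Qed.

Definition has_val (k : nat) (x : Q) : Prop :=
  exists u u', [/\ V u, V u', u * u' = 1 & x = p ^+ k * u].

Lemma has_val_unique k l x : has_val k x -> has_val l x -> k = l.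
Proof.
wlog lt_kl : k l / (k < l)%N => [WL kx lx|].
  by have [kl|lk|//] := ltngtP k l; [apply: WL | apply/esym/WL].
move=> [u [u' [Vu Vu' uu' ->]]] [v [v' [Vv _ _ e]]]; exfalso.
apply: (unit_nmaximal uu' Vu').
suff -> : u = p * (p ^+ (l - k).-1 * v).
  by rewrite mulrA [p' * p]mulrC pp' mul1r; apply: closureM => //; apply: closureX.
rewrite mulrA -exprS prednK ?subn_gt0 //.
have pk : p ^+ k * p' ^+ k = 1 by rewrite -exprMn pp' expr1n.
by apply: (lreg_of_inv pk); rewrite e mulrA -exprD subnKC // ltnW.
Qed.

Lemma has_val_mul k l x y : has_val k x -> has_val l y -> has_val (k + l) (x * y).
Proof.
move=> [u [u' [Vu Vu' uu' ->]]] [v [v' [Vv Vv' vv' ->]]].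
exists (u * v), (u' * v'); split; [exact: closureM | exact: closureM | |].
  by rewrite mulrACA uu' vv' mulr1.
by rewrite exprD mulrACA.
Qed.

Lemma has_val_inv k x : has_val k x -> exists2 x', x * x' = 1 & V (p ^+ k * x').
Proof.
move=> [u [u' [Vu Vu' uu' ->]]]; exists (p' ^+ k * u').
  by rewrite mulrACA -exprMn pp' expr1n uu' mulr1.
by rewrite mulrA -exprMn pp' expr1n mul1r.
Qed.

(** The least k such that some element of I is outside of p ^ (k + 1) V exists
    because the powers of p V intersect in 0. *)
Lemma minimal_val (I : set Q) x0 : I `<=` V -> I x0 -> x0 <> 0 ->
  exists k a, [/\ I a, has_val k a & forall x, I x -> V (p' ^+ k * x)].
Proof.
move=> IV Ix0 x0n0; have [_ _ _ _ sepV] := p_unif.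
have exk : exists k, `[< exists2 a, I a & ~ V (p' ^+ k.+1 * a) >].
  apply: contrapT => no; apply: x0n0; apply: sepV => -[|k].
    by rewrite expr0 mul1r; apply: IV.
  apply: contrapT => nV; apply: no; exists k.
  by apply/asboolP; exists x0.
have [k /asboolP[a Ia nVa] mink] := ex_minnP exk.
have IVk x : I x -> V (p' ^+ k * x).
  case: k {a Ia nVa} mink => [|k] mink Ix; first by rewrite mul1r; apply: IV.
  apply: contrapT => nV; suff : (k < k)%N by rewrite ltnn.
  by apply: mink; apply/asboolP; exists x.
exists k, a; split=> //.
case: (unit_or_maximal (IVk _ Ia)) => [|[u' Vu' uu']]; first by rewrite mulrA -exprS.
by exists (p' ^+ k * a), u'; split=> //; [apply: IVk | rewrite pX // subnn mul1r].
Qed.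

Lemma has_val_neq0 x : V x -> x <> 0 -> exists k, has_val k x.
Proof.
move=> Vx xn0; have [|k [a [-> ka _]]] := @minimal_val [set x] x _ erefl xn0.
  by move=> _ ->.
by exists k.
Qed.

Lemma has_val_div k a a' x : has_val k a -> a * a' = 1 ->
  V (p' ^+ k * x) -> V (a' * x).
Proof.
move=> ka aa' Vx; have [b ab Vb] := has_val_inv ka.
have <- : b = a' by apply: (lreg_of_inv aa'); rewrite ab.
rewrite (_ : b * x = (p ^+ k * b) * (p' ^+ k * x)); first exact: closureM.
by rewrite mulrACA -exprMn pp' expr1n mul1r.
Qed.

Lemma has_val_quotient k l a a' x : has_val k a -> a * a' = 1 ->
  has_val l x -> V (a' * x) -> exists2 j, has_val j (a' * x) & l = (k + j)%N.
Proof.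
move=> ka aa' lx Vax.
have xE : x = a * (a' * x) by rewrite mulrA aa' mul1r.
have [|j jax] := has_val_neq0 Vax.
  move=> ax0; rewrite xE ax0 mulr0 in lx; have [x' /eqP] := has_val_inv lx.
  by rewrite mul0r eq_sym oner_eq0.
exists j => //; apply: (has_val_unique lx); rewrite xE; exact: has_val_mul.
Qed.

Section Between.
Variable A : subring Q.
Hypotheses (RA : range f `<=` subring_set A) (AV : subring_set A `<=` V).

(** The contraction to A of the maximal ideal of V. *)
Definition max_below : set A := [set x | V (p' * val x)].

Lemma max_belowE (x : A) : max_below x = V (p' * val x). Proof. by []. Qed.

(** An element of A that is a unit of V is a unit of A, as its inverse is
    integral over A. *)
Lemma max_below_local : local_ring max_below.
Proof.
have idM : ideal max_below.
  split; first by rewrite max_belowE subring_val0 mulr0; apply: closure0.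
    by move=> x y Vx Vy; rewrite max_belowE subring_valD mulrDr; apply: closureD.
  move=> a x Vx; rewrite max_belowE subring_valM mulrCA; apply: closureM => //.
  by apply: AV; apply: subring_valP.
have M1 : ~ max_below 1 by rewrite max_belowE subring_val1 mulr1.
have unitA (x : A) : ~ max_below x -> exists y, x * y = 1.
  move=> nMx; have Ax := subring_valP x.
  case: (unit_or_maximal (AV Ax)) => // -[y Vy xy].
  have [z zy] := subring_lift (integral_inv_mem fracf RA Ax Vy xy).
  by exists z; apply: val_inj; rewrite subring_valM zy xy subring_val1.
have subM (J : set A) : ideal J -> ~ J 1 -> J `<=` max_below.
  move=> idJ J1 x Jx; apply: contrapT => /unitA[y xy]; apply: J1.
  by rewrite -xy; apply: ideal_mulr.
split; first by split=> // J idJ J1 MJ; apply/seteqP; split=> //; apply: subM.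
move=> N [idN N1 maxN]; apply/esym/maxN => //; exact: subM.
Qed.

Lemma jacobson_below : @jacobson_radical A = max_below.
Proof. exact/jacobson_local/max_below_local. Qed.

Lemma max_below_unit (x : A) : ~ max_below x -> exists y, x * y = 1.
Proof. exact/local_ring_unit/max_below_local. Qed.

Let ideal_submodule (I : set A) : ideal I -> submodule f [set val x | x in I].
Proof.
move=> idI; split; first by exists 0; [apply: ideal0 | rewrite subring_val0].
  by move=> _ _ [u Iu <-] [v Iv <-]; exists (u + v); [apply: ideal_add | rewrite subring_valD].
move=> c _ [u Iu <-].
have [|b be] := @subring_lift _ A (f c); first by apply: RA; exists c.
by exists (b * u); [apply: ideal_mull | rewrite subring_valM be].
Qed.

Section FiniteClosure.
Hypotheses (noeR : noetherian R) (finV : exists s, V = Defs.span f s).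
Variables (r : R) (regr : GRing.lreg r).
Hypothesis mr : V (p' * f r).

(** A power of J(A), a finite R-module containing the unit r ^ i of Q, is stable
    under its colon ring; the determinant trick applies. *)
Lemma blowup_sub_closure : subring_set (blowup A) `<=` V.
Proof.
move=> q [i _ qJ]; have [r' rr'] : exists r', f r * r' = 1 by case: fracf => _ + _; apply.
have idJ : ideal (ideal_exp (@jacobson_radical A) i).
  by apply: ideal_exp_ideal; apply: jacobson_ideal.
apply: (@integral_of_stable _ _ f noeR fracf finV (jacobson_pow A i) q (f r ^+ i) (r' ^+ i)) => //.
- exact: ideal_submodule.
- by move=> _ [x _ <-]; apply: AV; apply: subring_valP.
- have [|s se] := @subring_lift _ A (f r); first by apply: RA; exists r.
  exists (s ^+ i); last by rewrite subring_valX se.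
  by apply: ideal_exp_mem; rewrite jacobson_below max_belowE se.
- by rewrite -exprMn rr' expr1n.
Qed.

(** With a of least valuation in the maximal ideal M, the R-submodules
    M ^ j / a ^ j of V increase, hence become stationary: a generates a
    reduction of M.  So minimal multiplicity makes M ^ 2 = a M. *)
Lemma max_below_reduction :
  minimal_multiplicity (localization_at (maximal_prime (proj1 max_below_local))) ->
  exists (a : A) a' k, [/\ max_below a, has_val k.+1 (val a), val a * a' = 1,
    forall x, max_below x -> V (a' * val x) &
    forall x y, max_below x -> max_below y -> exists2 z, max_below z & x * y = a * z].
Proof.
move=> mm; have [[idM M1 _] _] := max_below_local.
have [s se] : exists s : A, val s = f r by apply: subring_lift; apply: RA; exists r.
have Ms : max_below s by rewrite max_belowE se.
have [|||k [_ [[a Ma <-] ka Vka]]] := @minimal_val [set val x | x in max_below] (f r).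
- by move=> _ [x _ <-]; apply: AV; apply: subring_valP.
- by exists s.
- move=> r0; have [r' /eqP] : exists r', f r * r' = 1 by case: fracf => _ + _; apply.
  by rewrite r0 mul0r eq_sym oner_eq0.
have [a' aa' _] := has_val_inv ka.
case: k => [|k] in ka Vka.
  have [u [u' [_ Vu' uu' ae]]] := ka.
  by case: (unit_nmaximal uu' Vu'); rewrite mul1r in ae; rewrite -ae.
have MV x : max_below x -> V (a' * val x).
  by move=> Mx; apply: (has_val_div ka aa'); apply: Vka; exists x.
exists a, a', k; split=> //.
have rega : GRing.lreg a.
  move=> x y /(congr1 val); rewrite !subring_valM => /(lreg_of_inv aa')/val_inj.
  by [].
pose S := prime_compl (maximal_prime (proj1 max_below_local)).
have inj : injective (to_loc S).
  move=> x y /frac_eqP[u /max_below_unit[v uv]]; rewrite !mulr1.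
  by apply: (lreg_of_inv uv).
have surj z : exists x, to_loc S x = z.
  have [x [t [ht ->]]] := fracP z; have [v tv] := max_below_unit ht.
  exists (x * v); apply/frac_eqP; exists 1; first exact: mul_subset1.
  by rewrite !mul1r mulr1 -mulrA [v * t]mulrC tv mulr1.
apply: (minimal_multiplicity_transfer inj surj mm max_below_local rega Ma).
pose N j := [set q | exists2 x, ideal_exp max_below j x & val x = val a ^+ j * q].
have idE j : ideal (ideal_exp max_below j) by apply: ideal_exp_ideal.
have expV j x : ideal_exp max_below j x -> V (a' ^+ j * val x).
  elim: j x => [|j IH] x; first by move=> _; rewrite mul1r; apply: AV; apply: subring_valP.
  pose I := [set x : A | V (a' ^+ j.+1 * val x)].
  have IE u : I u = V (a' ^+ j.+1 * val u) by [].
  have idI : ideal I.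
    split; first by rewrite IE subring_val0 mulr0; apply: closure0.
      by move=> u v Vu Vv; rewrite IE subring_valD mulrDr; apply: closureD.
    move=> b u Vu; rewrite IE subring_valM mulrCA; apply: closureM => //.
    by apply: AV; apply: subring_valP.
  move: x; apply: (ideal_mul_sub idI) => u v Mu /IH Vv.
  by rewrite IE subring_valM exprS mulrACA; apply: closureM => //; apply: MV.
have aXa' j : val a ^+ j * a' ^+ j = 1 by rewrite -exprMn aa' expr1n.
have [j|j q [x Ex xe]|j q [x Ex xe]|k0 kP] := submodule_acc noeR fracf finV (N := N).
- split; first by exists 0; [apply: ideal0 | rewrite subring_val0 mulr0].
    move=> q q' [u Eu ue] [v Ev ve]; exists (u + v); first exact: ideal_add.
    by rewrite subring_valD ue ve mulrDr.
  move=> c q [u Eu ue].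
  have [|b be] := @subring_lift _ A (f c); first by apply: RA; exists c.
  by exists (b * u); [apply: ideal_mull | rewrite subring_valM be ue mulrCA].
- suff -> : q = a' ^+ j * val x by apply: expV.
  by rewrite xe mulrA [_ * _ ^+ j]mulrC aXa' mul1r.
- by exists (a * x); [apply: ideal_mul_mem | rewrite subring_valM xe exprS mulrA].
(* the successor makes M ^ k0.+1 a subset of M *)
exists k0.+1 => n x Ex.
have [y Ey ye] : N k0 (a' ^+ (n + k0.+1) * val x).
  by apply: (kP (n + k0.+1)%N); exists x => //; rewrite mulrA aXa' mul1r.
exists (a * y); first exact: ideal_mulr.
apply: val_inj; rewrite !subring_valM subring_valX ye /= !mulrA -exprSr -exprD.
by rewrite addSnnS aXa' mul1r.
Qed.

End FiniteClosure.

(** If M ^ 2 = a M, then M ^ (i + 1) = a ^ i M for all i, so all the colons of the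
    blowup are contained in M : M = M / a: the blowup is M / a. *)
Section BlowupQuotient.
Variables (a : A) (a' : Q).
Hypotheses (Ma : max_below a) (aa' : val a * a' = 1).
Hypothesis MMa : forall x y, max_below x -> max_below y ->
  exists2 z, max_below z & x * y = a * z.

Lemma blowup_div x : max_below x -> subring_set (blowup A) (a' * val x).
Proof.
have [[idM _ _] _] := max_below_local.
move=> Mx; exists 1%N => // _ [y Ey <-].
have My : max_below y.
  move: y Ey; rewrite jacobson_below /=; apply: (ideal_mul_sub idM) => u v Mu _.
  exact: ideal_mulr.
have [z Mz xy] := MMa Mx My; exists z.
  rewrite jacobson_below -[z]mulr1; exact: (ideal_mul_mem Mz).
by rewrite -mulrA -subring_valM xy subring_valM mulrA [a' * _]mulrC aa' mul1r.
Qed.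

Lemma blowup_mul q : subring_set (blowup A) q -> subring_set A (val a * q).
Proof.
have [[idM _ _] _] := max_below_local.
move=> [i _ qJ]; have := qJ (val a ^+ i); case.
  exists (a ^+ i); last by rewrite subring_valX.
  by apply: ideal_exp_mem; rewrite jacobson_below.
have expM j : ideal_exp max_below j.+1 `<=` scale (a ^+ j) max_below.
  elim: j => [|j IH].
    apply: ideal_mul_sub => [|x y Mx _]; first exact: scale_ideal.
    by exists (x * y); [apply: ideal_mulr | rewrite mul1r].
  apply: ideal_mul_sub => [|x y Mx /IH[z Mz <-]]; first exact: scale_ideal.
  have [w Mw xz] := MMa Mx Mz; exists w => //.
  by rewrite mulrCA xz mulrA -exprSr.
case: i {qJ} => [|i] x.
  move=> _; rewrite expr0 mulr1 => <-.
  by apply: subring_setM; apply: subring_valP.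
rewrite jacobson_below => /expM[z Mz <-].
rewrite subring_valM subring_valX exprSr mulrCA => e.
have aX : val a ^+ i * a' ^+ i = 1 by rewrite -exprMn aa' expr1n.
by rewrite mulrC (lreg_of_inv aX (esym e)); apply: subring_valP.
Qed.

End BlowupQuotient.
End Between.
End Tower.

(** * Lipman's criterion and trace ideals *)

Section ArfTower.
Variables (R Q : comNzRingType) (f : {rmorphism R -> Q}).
Local Notation V := (integral_elements f).

Hypotheses (fracf : fraction_ring f) (noeR : noetherian R).
Hypothesis finV : exists s, V = Defs.span f s.
Variables (p p' : Q) (p_unif : uniformizer f p p').
Variables (r : R) (regr : GRing.lreg r).
Hypothesis mr : V (p' * f r).

Variable T : nat -> subring Q.
Hypotheses (T0 : subring_set (T 0) = range f) (TS : forall n, T n.+1 = blowup (T n)).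
Hypothesis T_minmult : forall n (M : set (T n)) (hM : maximal_ideal M),
  minimal_multiplicity (localization_at (maximal_prime hM)).

Lemma tower_between n :
  range f `<=` subring_set (T n) /\ subring_set (T n) `<=` V.
Proof.
elim: n => [|n [RT TV]].
  by rewrite T0; split=> // _ [x _ <-]; apply: closure_total.
rewrite TS; split; last exact: (blowup_sub_closure fracf p_unif RT TV noeR finV regr mr).
move=> x /RT Tx; exists 0%N => // _ [y _ <-].
have [z zE] := subring_lift (subring_setM Tx (subring_valP y)).
by exists z.
Qed.

(** The classical Arf condition, by induction on the valuation of x: if x is
    not a unit, then x, y, z lie in M = a T_1, where T_1 is the next ring of the
    tower, and the quotients x / a, y / a, z / a satisfy the same hypotheses in
    T_1, with a smaller valuation. *)
Lemma arf_quotient k n x x' y z : has_val f p k x -> x * x' = 1 ->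
  subring_set (T n) x -> subring_set (T n) y -> subring_set (T n) z ->
  V (x' * y) -> V (x' * z) -> subring_set (T n) (x' * y * z).
Proof.
have [k' le_k'k] := ubnP k; elim: k' => // k' IH in k le_k'k n x x' y z *.
move=> kx xx' Tx Ty Tz Vy Vz; have [RT TV] := tower_between n.
have Vx := TV _ Tx.
case: (unit_or_maximal p_unif Vx) => [Vpx|[u Vu xu]]; last first.
  have -> : x' = u by apply: (lreg_of_inv xx'); rewrite xx' xu.
  apply: subring_setM => //; apply: subring_setM => //.
  exact: (integral_inv_mem fracf RT Tx Vu xu).
have [a [a' [j [Ma ja aa' MV MMa]]]] :=
  max_below_reduction noeR finV regr mr
    (T_minmult (proj1 (max_below_local fracf p_unif RT TV))).
have div w : subring_set (T n) w -> V (p' * w) ->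
    subring_set (T n.+1) (a' * w) /\ V (a' * w).
  move=> /subring_lift[v <-] Mv; split; last exact: MV.
  by rewrite TS; exact: (blowup_div fracf p_unif RT TV aa' MMa Mv).
have maxV w : V (x' * w) -> V (p' * w).
  move=> Vw; have -> : p' * w = p' * x * (x' * w).
    by rewrite mulrA -[p' * x * x']mulrA xx' mulr1.
  exact: closureM.
have [Tx1 Vx1] := div x Tx Vpx.
have [Ty1 _] := div y Ty (maxV _ Vy); have [Tz1 _] := div z Tz (maxV _ Vz).
have [l lx1 kE] := has_val_quotient p_unif ja aa' kx Vx1.
have a'a : a' * val a = 1 by rewrite mulrC.
have inv1 : a' * x * (val a * x') = 1 by rewrite mulrACA a'a xx' mulr1.
have cancel w : val a * x' * (a' * w) = x' * w.
  by rewrite mulrACA aa' mul1r.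
have := IH l _ n.+1 _ _ (a' * y) (a' * z) lx1 inv1 Tx1 Ty1 Tz1.
rewrite !cancel => /(_ _ Vy Vz) Tq.
have -> : x' * y * z = val a * (x' * y * (a' * z)).
  by rewrite [x' * y * (a' * z)]mulrCA !mulrA aa' mul1r.
apply: (blowup_mul fracf p_unif RT TV Ma aa' MMa).
by rewrite -TS; apply: Tq; rewrite kE in le_k'k; lia.
Qed.

Section Trace.
Variable M : lmodType R.

Lemma mem_trace (g : {linear M -> R^o}) y : trace M (g y).
Proof. by exists 1%N, (fun=> g), (fun=> y); rewrite big_ord1. Qed.

(** The witness is the linear form z |-> x g(z) / g(y). *)
Lemma trace_of_quotients (g : {linear M -> R^o}) y a' x : f (g y) * a' = 1 ->
  (forall z, range f (a' * f x * f (g z))) -> trace M x.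
Proof.
move=> ga' gq; have [injf _ _] := fracf.
have ex z : exists w : R, f w = a' * f x * f (g z) by have [w _ we] := gq z; exists w.
have [h hE] := choice ex.
have linh : linear (h : M -> R^o).
  move=> b u v; apply: injf; rewrite hE linearP.
  transitivity (f (b * h u + h v)); last by [].
  transitivity (a' * f x * f (b * g u + g v)); first by [].
  by rewrite [in LHS]rmorphD [in RHS]rmorphD !rmorphM !hE mulrDr mulrCA.
pose hL : {linear M -> R^o} :=
  HB.pack h (GRing.isLinear.Build R M R^o *:%R h linh).
have <- : hL y = x by apply: injf; rewrite /= hE mulrAC [a' * _]mulrC ga' mul1r.
exact: mem_trace.
Qed.

(** With a = g y of least valuation k among all values of linear forms, the
    Arf condition lets one divide by a, so that all of a V and R is contained
    in the trace. *)
Lemma trace_cases d c : (forall x, V x -> range f (f d * x)) -> has_val f p c (f d) ->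
  trace M = [set 0] \/
  exists2 k, (k <= c)%N & trace M = [set x | V (p' ^+ k * f x)].
Proof.
move=> dV cd; have [injf _ _] := fracf.
have [[g [y gy0]]|no] := pselect (exists (g : {linear M -> R^o}) y, g y <> 0); last first.
  left; apply/seteqP; split=> [_ [n [g [y ->]]]|_ ->].
    by rewrite /= big1 // => i _; apply: contrapT => gy0; apply: no; exists (g i), (y i).
  by exists 0%N, (fun i : 'I_0 => False_rect _ (notF (ltn_ord i))), (fun=> 0); rewrite big_ord0.
right; pose I := [set q | exists (g : {linear M -> R^o}) y, q = f (g y)].
have [|||k [_ [[h [z ->]] kh minh]]] := @minimal_val _ _ f _ _ p_unif I (f (g y)).
- by move=> _ [h [z ->]]; apply: closure_total.
- by exists g, y.
- by rewrite -(rmorph0 f) => /injf.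
have [a' ha' _] := has_val_inv p_unif kh.
have divV w : V (p' ^+ k * w) -> V (a' * w) by apply: has_val_div kh ha'.
have Ih v : V (a' * f (h v)) by apply: divV; apply: minh; exists h, v.
have sub x : trace M x -> V (p' ^+ k * f x).
  move=> [n [l [v ->]]]; rewrite rmorph_sum mulr_sumr.
  apply: (big_ind V) => [|u w|i _]; [exact: closure0 | exact: closureD |].
  by apply: minh; exists (l i), (v i).
exists k.
  have Td : trace M d.
    apply: (trace_of_quotients ha') => v.
    by rewrite [a' * _]mulrC -mulrA; apply: dV.
  by have [j _ ->] := has_val_quotient p_unif kh ha' cd (divV _ (sub _ Td)); apply: leq_addr.
apply/seteqP; split=> [|x Vx]; first exact: sub.
apply: (trace_of_quotients ha') => v; rewrite -T0.
apply: (arf_quotient kh ha'); rewrite ?T0 //; last exact: divV; by eexists.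
Qed.

End Trace.
End ArfTower.

Theorem corollary5p5 (R : comNzRingType) (m : set R)
  (R_CM : cohen_macaulay_local m 1)
  (R_arf : arf R)
  (closure_fin : finite_integral_closure R)
  (closure_local : exists n : set (integral_closure R), local_ring n) :
  finite_set (trace_ideals R).
Proof.
have [noeR locR dimR [[s [[[regs _] sm] sz_s]] _]] := R_CM.
have [n locn] := closure_local.
have [r mr regr] : exists2 r, m r & GRing.lreg r.
  case: s sz_s regs sm => [//|r [|//]] _ regs sm.
  exists r; first by apply: sm; rewrite inE.
  move=> x y /eqP; rewrite -subr_eq0 -mulrBr => /eqP rxy; apply/eqP; rewrite -subr_eq0.
  have [||c ->] := regs 0%N _ (x - y) => //; last by rewrite big_ord0.
  by exists (fun=> 0); rewrite big_ord0.
have fracf := total_fraction_ring R.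
have [p [p' p_unif]] := uniformizer_exists noeR locR dimR mr regr fracf closure_fin
  (erefl _ : subring_set (integral_closure R) = integral_elements (to_total R)) locn.
have Vpr : integral_elements (to_total R) (p' * to_total R r).
  case: p_unif => _ _ _ unitV _; have [//|[y Vy ry]] := unitV _ (closure_total _ r).
  have [d rd] := integral_inv_total fracf Vy ry.
  by have [[idm m1 _] _] := locR; case: m1; rewrite -rd; apply: ideal_mulr.
have [d [regd dV]] := common_denominator fracf closure_fin.
have [c cd] : exists c, has_val (to_total R) p c (to_total R d).
  apply: (has_val_neq0 p_unif); first exact: closure_total.
  have [d' dd'] := lreg_total_inv regd.
  by move=> d0; move/eqP: dd'; rewrite d0 mul0r eq_sym oner_eq0.
pose I k := [set x | integral_elements (to_total R) (p' ^+ k * to_total R x)].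
apply: (@sub_finite_set _ _ ([set [set 0]] `|` I @` `I_c.+1)); last first.
  by rewrite finite_setU; split; [exact: finite_set1 | exact/finite_image/finite_II].
move=> _ [M ->].
have [|[k kc ->]] := trace_cases fracf noeR closure_fin p_unif regr Vpr
  (erefl : subring_set (tower R 0) = range (to_total R))
  (fun=> erefl) R_arf M dV cd; first by left.
by right; exists k.
Qed.
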